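(* There exist groups $G,G'\in\langle\langle F_n\rangle\rangle$ such that: \begin{itemize} \item $G,G'$ do not act properly discontinuously and cocompactly by isometries on the same proper geodesic metric space. \item $G,G'$ do not have discrete, cocompact, virtually faithful representations into the same locally compact group. \end{itemize}
   Context: $F_n$ denotes the free group of rank $n\ge2$, and $\langle\langle F_n\rangle\rangle$ denotes the class of finitely generated groups quasi-isometric to $F_n$ (this class does not depend on $n\ge2$; it is the class of groups that are virtually free of finite rank $\ge2$). A representation (homomorphism) of a group into a locally compact topological group is discrete and cocompact if its image is a discrete, cocompact subgroup, and virtually faithful if its kernel is finite. *)

(* Defs.v *)
From HB Require Import structures.
From mathcomp Require Import all_boot all_order all_algebra.
From mathcomp Require Import generic_quotient all_classical all_reals topology.

Set Implicit Arguments.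
Unset Strict Implicit.
Unset Printing Implicit Defensive.

Import Order.TTheory GRing.Theory Num.Theory.

Local Open Scope classical_set_scope.
Local Open Scope ring_scope.
Local Open Scope quotient_scope.

(* The letter (i, false) is the i-th free generator and (i, true) is its
   inverse; elements of the free group are the freely reduced words. *)
Section FreeGroup.
Variable n : nat.

Definition letter : Type := ('I_n * bool)%type.

Definition letterV (a : letter) : letter := (a.1, ~~ a.2).

Definition reduced (w : seq letter) : bool :=
  sorted (fun a b => b != letterV a) w.

Record free_group : Type :=
  FreeGroup { word_of :> seq letter; word_ofP : reduced word_of }.

HB.instance Definition _ := [isSub for word_of].
HB.instance Definition _ := [Choice of free_group by <:].

Definition push (a : letter) (w : seq letter) : seq letter :=
  if w is b :: w' then if b == letterV a then w' else a :: w else [:: a].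

Definition word_mul (u v : seq letter) : seq letter := foldr push v u.

Definition word_inv (u : seq letter) : seq letter := rev (map letterV u).

Lemma letterVK : involutive letterV.
Proof. by case=> i b; rewrite /letterV /= negbK. Qed.

Lemma push_reduced a w : reduced w -> reduced (push a w).
Proof.
case: w => [|b w] //= rw; case: ifPn => [_|nb].
  exact: (path_sorted rw).
by rewrite /reduced /= nb.
Qed.

Lemma word_mul_reduced u v : reduced v -> reduced (word_mul u v).
Proof. by move=> rv; elim: u => //= a u; apply: push_reduced. Qed.

Lemma pushK a w : reduced w -> push a (push (letterV a) w) = w.
Proof.
case: w => [|b w] /= rw; first by rewrite eqxx.
rewrite letterVK; case: ifPn => [/eqP ba|_]; last by rewrite /= eqxx.
by subst b; case: w rw => [|c w] //= /andP[/negbTE ->].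
Qed.

Lemma push_mul a u v : reduced u -> reduced v ->
  word_mul (push a u) v = push a (word_mul u v).
Proof.
case: u => [|b u] //= ru rv; case: ifPn => [/eqP ->|//].
by rewrite pushK // word_mul_reduced.
Qed.

Lemma word_mulA u v w : reduced v -> reduced w ->
  word_mul u (word_mul v w) = word_mul (word_mul u v) w.
Proof.
move=> rv rw; elim: u => //= a u ->.
by rewrite push_mul // word_mul_reduced.
Qed.

Lemma word_mul0 u : reduced u -> word_mul u [::] = u.
Proof.
elim: u => //= a u IHu rau; rewrite IHu; last exact: path_sorted rau.
by case: u rau {IHu} => [|b u] //= /andP[/negbTE ->].
Qed.

Lemma word_inv_reduced u : reduced u -> reduced (word_inv u).
Proof.
rewrite /reduced /word_inv rev_sorted sorted_map.
case: u => //= a u; apply: sub_path => x y /=.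
by apply: contra => /eqP/(can_inj letterVK) ->; rewrite letterVK.
Qed.

Lemma word_invK : involutive word_inv.
Proof.
move=> u; rewrite /word_inv map_rev revK -map_comp map_id_in // => a _ /=.
exact: letterVK.
Qed.

Lemma word_mul_cat u v w : word_mul (u ++ v) w = word_mul u (word_mul v w).
Proof. exact: foldr_cat. Qed.

Lemma word_mulVw u w : reduced w -> word_mul (word_inv u) (word_mul u w) = w.
Proof.
move=> rw; elim: u => //= a u IHu.
rewrite /word_inv map_cons rev_cons -cats1 word_mul_cat /=.
by rewrite -{2}[a]letterVK pushK ?word_mul_reduced.
Qed.

Definition free_one : free_group := @FreeGroup [::] isT.
Definition free_inv (x : free_group) : free_group :=
  FreeGroup (word_inv_reduced (word_ofP x)).
Definition free_mul (x y : free_group) : free_group :=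
  FreeGroup (word_mul_reduced x (word_ofP y)).

Lemma free_mulA : associative free_mul.
Proof. by move=> x y z; apply: val_inj; rewrite /= word_mulA ?word_ofP. Qed.

Lemma free_mul1g : left_id free_one free_mul.
Proof. by move=> x; apply: val_inj. Qed.

Lemma free_mulg1 : right_id free_one free_mul.
Proof. by move=> x; apply: val_inj; rewrite /= word_mul0 ?word_ofP. Qed.

Lemma free_mulVg : left_inverse free_one free_inv free_mul.
Proof.
move=> x; apply: val_inj => /=.
by rewrite -[X in word_mul _ X](word_mul0 (word_ofP x)) word_mulVw.
Qed.

Lemma free_mulgV : right_inverse free_one free_inv free_mul.
Proof.
move=> x; have := free_mulVg (free_inv x); congr (free_mul _ _ = _).
by apply: val_inj; rewrite /= word_invK.
Qed.

HB.instance Definition _ := isGroup.Build free_group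
  free_mulA free_mul1g free_mulg1 free_mulVg free_mulgV.

End FreeGroup.

Section QuasiIsometry.
Variable R : realType.

Section WordMetric.
Variables (G : groupType) (S : seq G).

Definition word_over (w : seq G) : bool :=
  all (fun x => (x \in S) || (x^-1%g \in S)) w.

Definition spelled_in (k : nat) (g : G) : Prop :=
  exists w : seq G,
    [/\ word_over w, size w = k & (\prod_(x <- w) x)%g = g].

Definition generates : Prop := forall g : G, exists k, spelled_in k g.

(* The least length of a word spelling g; the default value 0 is only reached
   when no word spells g, hence never when S generates G. *)
Definition word_norm (g : G) : nat :=
  xget 0%N [set k | spelled_in k g /\ forall j, spelled_in j g -> (k <= j)%N].

Definition word_dist (g h : G) : R := (word_norm (g^-1 * h)%g)%:R.

End WordMetric.

Definition quasi_isometric (X Y : Type) (dX : X -> X -> R) (dY : Y -> Y -> R)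
    : Prop :=
  exists (f : X -> Y) (K C : R),
    [/\ 1 <= K, 0 <= C,
        forall x x', K^-1 * dX x x' - C <= dY (f x) (f x') <= K * dX x x' + C
      & forall y, exists x, dY (f x) y <= C].

(* Both groups are required to be finitely generated; the choice of the finite
   generating sets is immaterial, as it changes a word metric only up to
   bi-Lipschitz equivalence. *)
Definition quasi_isometric_groups (G H : groupType) : Prop :=
  exists (S : seq G) (T : seq H),
    [/\ generates S, generates T
      & quasi_isometric (word_dist S) (word_dist T)].

Definition qi_to_free_group (n : nat) (G : groupType) : Prop :=
  quasi_isometric_groups G (free_group n).

End QuasiIsometry.

(* The quotient of a space by the equivalence relation f x = f y; with f x the
   orbit (resp. the coset) of x, it is the orbit space (resp. the coset space)
   with its quotient topology. *)
Section FiberQuotient.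
Variables (T : topologicalType) (Y : Type) (f : T -> Y).

Definition same_fiber : rel T := fun x y => `[< f x = f y >].

Lemma same_fiber_refl : reflexive same_fiber.
Proof. by move=> x; apply/asboolP. Qed.

Lemma same_fiber_sym : symmetric same_fiber.
Proof. by move=> x y; apply/asboolP/asboolP => ->. Qed.

Lemma same_fiber_trans : transitive same_fiber.
Proof. by move=> y x z /asboolP xy /asboolP yz; apply/asboolP; rewrite xy. Qed.

Canonical same_fiber_equiv :=
  EquivRel same_fiber same_fiber_refl same_fiber_sym same_fiber_trans.

Definition fiber_quotient : topologicalType :=
  quotient_topology {eq_quot same_fiber_equiv}.

End FiberQuotient.

Section GeometricActions.
Variables (R : realType) (X : metricType R).

Definition proper_space : Prop :=
  forall (x : X) (r : R), compact [set y | mdist x y <= r].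

Definition geodesic_space : Prop :=
  forall x y : X, exists c : R -> X,
    [/\ c 0 = x, c (mdist x y) = y
      & forall s t, 0 <= s <= mdist x y -> 0 <= t <= mdist x y ->
          mdist (c s) (c t) = `|s - t|].

Variables (G : groupType) (act : G -> X -> X).

Definition is_left_action : Prop :=
  (forall x, act 1%g x = x) /\
  (forall g h x, act (g * h)%g x = act g (act h x)).

Definition acts_by_isometries : Prop :=
  is_left_action /\ forall g x y, mdist (act g x) (act g y) = mdist x y.

Definition properly_discontinuous : Prop :=
  forall K : set X, compact K -> finite_set [set g | act g @` K `&` K !=set0].

Definition orbit_of (x : X) : set X := range (fun g => act g x).

Definition cocompact_action : Prop := compact [set: fiber_quotient orbit_of].

End GeometricActions.

HB.mixin Record isTopologicalGroup L & Topological L & Group L := {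
  mulg_continuous : continuous (fun x : L * L => (x.1 * x.2)%g);
  invg_continuous : continuous (fun x : L => x^-1%g)
}.

#[short(type="topologicalGroupType")]
HB.structure Definition TopologicalGroup :=
  { L of Topological L & Group L & isTopologicalGroup L }.

Section Representations.
Variables (G : groupType) (L : topologicalGroupType).

Definition left_coset (H : set L) (x : L) : set L :=
  [set (x * h)%g | h in H].

Definition cocompact_subgroup (H : set L) : Prop :=
  compact [set: fiber_quotient (left_coset H)].

Definition discrete_subgroup (H : set L) : Prop := H `<=` isolated H.

Variable rho : UMagmaMorphism.type G L.

Definition discrete_cocompact_rep : Prop :=
  discrete_subgroup (range rho) /\ cocompact_subgroup (range rho).

Definition virtually_faithful : Prop := finite_set [set g | rho g = 1%g].

End Representations.

(* Main.v *)
(* Take G = Z/3 * Z/3 and G' = Z/5 * Z/5. A common model space or a common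
   locally compact group yields a single connected graph, of possibly infinite
   valence, on which both groups act by automorphisms, coboundedly and properly.
   Its cuts, that is vertex sets with coboundary in a ball, taken modulo bounded
   sets, form a Boolean algebra of subsets of the space of ends. Following
   Dunwoody and Kron, one minimizes the number of cuts of a fixed radius that
   cross a given cut, and then, among the minimizers, the number of minimizers
   that cross it: the two numbers are submodular on opposite corners, so the
   cuts that are optimal for both form a nested family, invariant under all
   automorphisms of the graph. This family plays the role of the edges of a
   tree. Each copy of Z/p in Z/p * Z/p acts on it as on a tree with a fixed
   vertex, and ping-pong shows that some cut D has exactly p - 1 maximal members
   of the family strictly below it, and so has its complement. The family of
   all images of D and its complement under graph automorphisms has the same
   properties, hence all its members have p - 1 maximal members below them,
   which determines p. *)
From HB Require Import structures.
Require Import Defs.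
From mathcomp Require Import all_boot all_order all_algebra.
From mathcomp Require Import generic_quotient finmap zify lra.
From mathcomp Require Import all_classical all_reals topology.

Set Implicit Arguments.
Unset Strict Implicit.
Unset Printing Implicit Defensive.

Import Order.TTheory GRing.Theory Num.Theory.

Local Open Scope classical_set_scope.

(** * Free products of two cyclic groups *)

(** As valence may be infinite, no finiteness can be read off the graph; both counts of crossings
    are finite only because a group acts properly. Along the orbit, a cut of radius R is locally
    constant outside a word ball whose size depends on R alone, and every cut is decided on all word
    cones of some finite depth; as there are finitely many syllables, only finitely many sets are
    decided at a given depth. In the other direction, all cones are cut out by one radius, so a set
    that splits deep cones is crossed by many cuts and cannot be a minimizer. The first group alone
    produces the nested family. The second one acts on it merely because the family is invariant
    under all graph automorphisms, so both primes are read off one object. The primes are odd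
    because each factor must contain three distinct elements 0, 1, -1: this keeps nested cones
    apart, drives the ping-pong, and makes the word tree branch. Membership in the class is proved
    separately, by coding the free product and the free group as vertices of the same binary
    tree. *)

Section FreeProduct.
Local Open Scope ring_scope.
Variable p : nat.

(* The letter (s, k) is the element k of the copy of Z/p indexed by s. *)
Definition syllable : Type := (bool * 'F_p)%type.

Definition alternating (w : seq syllable) : bool :=
  all (fun a => a.2 != 0) w && sorted (fun a b => a.1 != b.1) w.

Record free_product : Type :=
  FreeProduct { syl_of :> seq syllable; syl_ofP : alternating syl_of }.

HB.instance Definition _ := [isSub for syl_of].
HB.instance Definition _ := [Choice of free_product by <:].

Definition sylV (a : syllable) : syllable := (a.1, - a.2).

Definition spush (a : syllable) (w : seq syllable) : seq syllable :=
  if a.2 == 0 then w else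
  if w is b :: w' then
    if a.1 == b.1 then
      if a.2 + b.2 == 0 then w' else (a.1, a.2 + b.2) :: w'
    else a :: w
  else [:: a].

Definition smul (u v : seq syllable) : seq syllable := foldr spush v u.

Definition sinv (u : seq syllable) : seq syllable := rev (map sylV u).

Lemma sylVK : involutive sylV.
Proof. by case=> s x; rewrite /sylV opprK. Qed.

Lemma alternating_cons a w :
  alternating (a :: w) =
  [&& a.2 != 0, if w is b :: _ then a.1 != b.1 else true & alternating w].
Proof.
rewrite /alternating; case: w => [|b w] /=; first by rewrite !andbT.
by rewrite -!andbA; do !bool_congr.
Qed.

Lemma alternating_behead a w : alternating (a :: w) -> alternating w.
Proof. by rewrite alternating_cons => /and3P[]. Qed.

Lemma spush_alternating a w : alternating w -> alternating (spush a w).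
Proof.
rewrite /spush; case: eqP => // /eqP a0; case: w => [|b w] rw.
  by rewrite alternating_cons a0.
case: eqP => [ab|/eqP ab]; last by rewrite alternating_cons a0 ab rw.
move: rw; rewrite alternating_cons => /and3P[b0 hw rw].
by case: eqP => // /eqP ab0; rewrite alternating_cons /= ab0 rw ab hw.
Qed.

Lemma smul_alternating u v : alternating v -> alternating (smul u v).
Proof. by move=> rv; elim: u => //= a u; apply: spush_alternating. Qed.

Lemma spush_cons a w : alternating (a :: w) -> spush a w = a :: w.
Proof.
rewrite alternating_cons /spush => /and3P[/negbTE ->].
by case: w => [|b w] // /negbTE ->.
Qed.

(** Each factor acts on the normal forms (van der Waerden's trick): associativity and the inverse
    law both rest on this case analysis. *)
Lemma spushD s x y w : alternating w ->
  spush (s, x) (spush (s, y) w) = spush (s, x + y) w.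
Proof.
move=> rw; rewrite /spush /=.
have [->|x0] := eqVneq x 0; first by rewrite add0r.
have [->|y0] := eqVneq y 0; first by rewrite addr0 (negbTE x0).
case: w rw => [|b w] rw; first by rewrite eqxx.
have [sb|sb] := eqVneq s b.1; last by rewrite eqxx.
have h : if w is c :: _ then (s == c.1) = false else true.
  move: rw; rewrite alternating_cons sb => /and3P[_ + _].
  by case: (w) => // c v /negbTE.
have b0 : b.2 != 0 by move: rw; rewrite alternating_cons => /and3P[].
have [yb|yb] := eqVneq (y + b.2) 0.
  have -> : (x + y + b.2 == 0) = (x == 0) by rewrite -addrA yb addr0.
  have [xy|xy] := eqVneq (x + y) 0.
    have -> : x = b.2.
      apply: (addIr y); rewrite xy addrC; exact/esym.
    by case: (w) h => [_|c v ->]; rewrite sb; case: (b).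
  rewrite (negbTE x0) -addrA yb addr0.
  by case: (w) h => [//|c v] ->.
rewrite /= eqxx -addrA.
have [xy|xy] := eqVneq (x + y) 0; last by [].
by rewrite addrA xy add0r (negbTE b0) sb; case: (b).
Qed.

Lemma spushK a w : alternating w -> spush a (spush (sylV a) w) = w.
Proof.
by case: a => s x rw; rewrite spushD // subrr /spush eqxx.
Qed.

Lemma smul_spush a u v : alternating u -> alternating v ->
  smul (spush a u) v = spush a (smul u v).
Proof.
rewrite {1}/spush => ru rv; case: eqP => [a0|/eqP a0].
  by rewrite /spush a0 eqxx.
case: u ru => [|b u] //= ru; case: eqP => [ab|//].
have rbv := smul_alternating u rv.
have -> : spush a (spush b (smul u v)) = spush (a.1, a.2 + b.2) (smul u v).
  by rewrite -spushD // {2}ab; case: (a); case: (b).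
by case: eqP => [e|_ //]; rewrite /spush /= e eqxx.
Qed.

Lemma smulA u v w : alternating v -> alternating w ->
  smul u (smul v w) = smul (smul u v) w.
Proof.
move=> rv rw; elim: u => //= a u ->.
by rewrite smul_spush // smul_alternating.
Qed.

Lemma smul0 u : alternating u -> smul u [::] = u.
Proof.
elim: u => //= a u IHu rau; rewrite IHu ?spush_cons //.
exact: alternating_behead rau.
Qed.

Lemma smul_cat u v w : smul (u ++ v) w = smul u (smul v w).
Proof. exact: foldr_cat. Qed.

Lemma sinv_cons a u : sinv (a :: u) = rcons (sinv u) (sylV a).
Proof. by rewrite /sinv map_cons rev_cons. Qed.

Lemma sinvK : involutive sinv.
Proof.
move=> u; rewrite /sinv map_rev revK -map_comp map_id_in // => a _ /=.
exact: sylVK.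
Qed.

Lemma sinv_alternating u : alternating u -> alternating (sinv u).
Proof.
rewrite /alternating /sinv all_rev all_map rev_sorted sorted_map.
case/andP=> h s; apply/andP; split.
  by apply: sub_all h => a /=; rewrite oppr_eq0.
by case: u s {h} => // a u; apply: sub_path => x y /=; rewrite eq_sym.
Qed.

Lemma smulV u w : alternating w -> smul (sinv u) (smul u w) = w.
Proof.
move=> rw; elim: u => //= a u IHu.
rewrite sinv_cons -cats1 smul_cat /=.
by rewrite -{2}[a]sylVK spushK ?smul_alternating.
Qed.

Definition fp_one : free_product := @FreeProduct [::] isT.
Definition fp_inv (x : free_product) : free_product :=
  FreeProduct (sinv_alternating (syl_ofP x)).
Definition fp_mul (x y : free_product) : free_product :=
  FreeProduct (smul_alternating x (syl_ofP y)).

Lemma fp_mulA : associative fp_mul.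
Proof. by move=> x y z; apply: val_inj; rewrite /= smulA ?syl_ofP. Qed.

Lemma fp_mul1g : left_id fp_one fp_mul.
Proof. by move=> x; apply: val_inj. Qed.

Lemma fp_mulg1 : right_id fp_one fp_mul.
Proof. by move=> x; apply: val_inj; rewrite /= smul0 ?syl_ofP. Qed.

Lemma fp_mulVg : left_inverse fp_one fp_inv fp_mul.
Proof.
move=> x; apply: val_inj => /=.
by rewrite -[X in smul _ X](smul0 (syl_ofP x)) smulV.
Qed.

Lemma fp_mulgV : right_inverse fp_one fp_inv fp_mul.
Proof.
move=> x; have := fp_mulVg (fp_inv x); congr (fp_mul _ _ = _).
by apply: val_inj; rewrite /= sinvK.
Qed.

HB.instance Definition _ := isGroup.Build free_product
  fp_mulA fp_mul1g fp_mulg1 fp_mulVg fp_mulgV.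

End FreeProduct.

(** * Syllable length, prefixes and absence of cancellation *)

Section FreeProductWords.
Local Open Scope ring_scope.
Variable p : nat.
Local Notation G := (free_product p).
Local Notation syllable := (syllable p).
Implicit Types (a b : syllable) (u v w : seq syllable) (g h : G).

Definition flen g : nat := size g.

Definition syl a : G := FreeProduct (spush_alternating a (syl_ofP 1%g)).

Lemma syl_ofM g h : syl_of (g * h)%g = smul g h. Proof. by []. Qed.

Lemma syl_ofV g : syl_of (g^-1)%g = sinv g. Proof. by []. Qed.

Lemma syl_eq1 s : syl (s, 0) = 1%g.
Proof. by apply: val_inj; rewrite /= /spush eqxx. Qed.

Lemma sylM s x y : (syl (s, x) * syl (s, y))%g = syl (s, x + y).
Proof.
apply: val_inj => /=.
rewrite [X in smul X _]/spush /=; case: eqP => [->|/eqP x0] /=.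
  by rewrite add0r.
by rewrite spushD.
Qed.

Lemma size_spush a w : (size (spush a w) <= (size w).+1)%N.
Proof.
rewrite /spush; case: ifP => // _; case: w => //= b w.
case: ifP => //= _; case: ifP => //= _; lia.
Qed.

Lemma flenM g h : (flen (g * h)%g <= flen g + flen h)%N.
Proof.
rewrite /flen syl_ofM; elim: (syl_of g) => //= a u IH.
by apply: leq_trans (size_spush _ _) _; rewrite addSn ltnS.
Qed.

Lemma flenV g : flen (g^-1)%g = flen g.
Proof. by rewrite /flen syl_ofV /sinv size_rev size_map. Qed.

Lemma flen_syl a : (flen (syl a) <= 1)%N.
Proof. exact: (size_spush a [::]). Qed.

Lemma alternating_join u v a b :
  alternating (rcons u a ++ b :: v) =
  [&& alternating (rcons u a), alternating (b :: v) & a.1 != b.1].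
Proof.
elim: u => [|c u IH] /=.
  by rewrite !alternating_cons /= andbT; case: (a.2 != 0) => //=; rewrite andbC.
rewrite alternating_cons IH alternating_cons.
by case: u {IH} => /= *; rewrite -!andbA; do !bool_congr.
Qed.

Lemma alternating_catl u v : alternating (u ++ v) -> alternating u.
Proof.
elim: u => //= a u IH; rewrite !alternating_cons => /and3P[-> h /IH ->].
by case: u h {IH} => //= b u ->.
Qed.

Lemma alternating_catr u v : alternating (u ++ v) -> alternating v.
Proof. by elim: u => //= a u IH /alternating_behead. Qed.

Lemma smul_alt u v : alternating (u ++ v) -> smul u v = u ++ v.
Proof.
elim: u => //= a u IH rauv; rewrite IH ?spush_cons //.
exact: alternating_behead rauv.
Qed.

Lemma smulV_prefix w v : alternating (w ++ v) -> smul (sinv w) (w ++ v) = v.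
Proof.
move=> rv; rewrite -(smul_alt rv) smulV //; exact: alternating_catr rv.
Qed.

(* No cancellation reaches beyond the point where v leaves w. *)
Lemma head_smulV w v a : alternating (rcons w a) -> alternating v ->
  ~~ prefix (rcons w a) v ->
  exists c t, smul (sinv (rcons w a)) v = c :: t /\ c.1 = a.1.
Proof.
elim: w v => [|b w IH] v rw rv npre.
  rewrite /= /sinv /= /rev /=.
  have a0 : a.2 != 0 by move: rw; rewrite /= alternating_cons => /and3P[].
  rewrite /spush /= oppr_eq0 (negbTE a0).
  case: v rv npre => [|c v] rv npre; first by exists (sylV a), [::].
  case: eqP => [ac|/eqP ac]; last by exists (sylV a), (c :: v).
  case: eqP => [e|/eqP e]; last by eexists; eexists; split; [reflexivity|].
  move: npre; rewrite /= prefix0s andbT.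
  have -> : a = c; last by rewrite eqxx.
  case: a ac e {rw a0} => s x; case: c {rv} => t y /= -> e.
  by congr (_, _); apply/esym/eqP; rewrite -subr_eq0 addrC e.
rewrite rcons_cons sinv_cons -cats1 smul_cat /=.
have rw' : alternating (rcons w a) by move: rw => /= /alternating_behead.
have b0 : b.2 != 0 by move: rw; rewrite /= alternating_cons => /and3P[].
apply: IH => //; first exact: spush_alternating.
apply: contra npre; rewrite /spush /= oppr_eq0 (negbTE b0).
have hw c t : prefix (rcons w a) (c :: t) -> b.1 = c.1 -> False.
  move: rw; rewrite /= alternating_cons => /and3P[_ + _].
  by case: (w) => [|d w'] /= h /andP[/eqP <-] _ bc; rewrite bc eqxx in h.
case: v rv => [|c v] rv.
  by move/hw => /(_ erefl).
case: eqP => [bc|_]; last by move/hw => /(_ erefl).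
case: eqP => [e|_]; last by move/hw => /(_ erefl).
move=> h; rewrite /= h andbT; apply/eqP.
case: b bc e {rw b0 hw} => s x; case: c {rv} => t y /= -> e.
by congr (_, _); apply/esym/eqP; rewrite -subr_eq0 addrC e.
Qed.

(** Tree-likeness of the normal forms: w^-1 g is empty or starts in the factor in which w does not
    end, while w^-1 h starts in the factor in which w ends, by [head_smulV]. Nothing cancels or
    merges between the two. *)
Lemma flen_prefix (w g h : G) : (0 < flen w)%N -> prefix w g -> ~~ prefix w h ->
  flen (g^-1 * h)%g = (flen (w^-1 * g)%g + flen (w^-1 * h)%g)%N.
Proof.
move=> w0 wg wh.
have -> : (g^-1 * h = (w^-1 * g)^-1 * (w^-1 * h))%g.
  by rewrite invgM invgK -mulgA mulVKg.
rewrite -[in RHS]flenV; move: w0 wg wh.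
rewrite /flen !(syl_ofM, syl_ofV).
case/lastP: (syl_of w) (syl_ofP w) => // w' a rw _ wg wh.
have [c [t [e ca]]] := head_smulV rw (syl_ofP h) wh.
have /prefixP[d gd] := wg.
have := syl_ofP g; rewrite gd => rg.
rewrite smulV_prefix // e -size_cat smul_alt //.
case: d rg {gd} => [|b d] rg.
  by rewrite -e; apply: smul_alternating; apply: syl_ofP.
move: rg; rewrite alternating_join => /and3P[_ rbd ab].
rewrite sinv_cons alternating_join -e smul_alternating ?syl_ofP //.
rewrite -sinv_cons sinv_alternating //= ca eq_sym; exact: ab.
Qed.

Lemma flen_prefixl (w g h : G) : (0 < flen w)%N -> prefix w g -> ~~ prefix w h ->
  (flen (w^-1 * g)%g <= flen (g^-1 * h)%g)%N.
Proof. by move=> w0 wg wh; rewrite (flen_prefix w0 wg wh) leq_addr. Qed.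

Lemma flen_sub g h : (flen h - flen g <= flen (g^-1 * h)%g)%N.
Proof. by have := flenM g (g^-1 * h)%g; rewrite mulVKg; lia. Qed.

Lemma take_alternating k g : alternating (take k g).
Proof. by apply: (@alternating_catl _ (drop k g)); rewrite cat_take_drop syl_ofP. Qed.

Definition ftake k g : G := FreeProduct (take_alternating k g).

Lemma flen_take k g : (k <= flen g)%N -> flen (ftake k g) = k.
Proof. by move=> kg; rewrite /flen /= size_takel. Qed.

Lemma ftake_ge k g : (flen g <= k)%N -> ftake k g = g.
Proof. by move=> gk; apply: val_inj; rewrite /= take_oversize. Qed.

Lemma prefix_ftake k g : prefix (ftake k g) g.
Proof. exact: prefix_take. Qed.

Lemma ftake_prefix (w g : G) : prefix w g -> ftake (flen w) g = w.
Proof.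
move=> /prefixP[t e]; apply: val_inj.
by rewrite /= e take_size_cat.
Qed.

Lemma prefix_ftakeP (w g : G) : prefix w g = (ftake (flen w) g == w).
Proof.
apply/idP/eqP => [|<-]; [exact: ftake_prefix | exact: prefix_ftake].
Qed.

Lemma ftake_take i j g : (i <= j)%N -> ftake i (ftake j g) = ftake i g.
Proof. by move=> ij; apply: val_inj; rewrite /= take_takel. Qed.

Lemma ftakeS k g a0 : (k < flen g)%N ->
  ftake k.+1 g = (ftake k g * syl (nth a0 g k))%g.
Proof.
move=> kg; apply: val_inj.
have -> : val (ftake k g * syl (nth a0 g k))%g
  = smul (take k g) (spush (nth a0 g k) [::]) by [].
rewrite /=; have e := take_nth a0 kg.
have n0 : (nth a0 g k).2 != 0.
  by have /andP[/allP h _] := syl_ofP g; apply/h/mem_nth.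
rewrite spush_cons; last by rewrite alternating_cons n0.
by rewrite smul_alt cats1 -e ?take_alternating.
Qed.

(** Consecutive prefixes differ by right multiplication by one syllable. This transports a cut,
    known to change only near its centre, along a normal form. *)
Lemma ftake_const (Q D : set G) k g :
  (forall h a, D h -> (Q h <-> Q (h * syl a)%g)) ->
  (forall i, (k <= i < flen g)%N -> D (ftake i g)) ->
  Q (ftake k g) <-> Q g.
Proof.
move=> QD Dg.
have [gk|kg] := leqP (flen g) k; first by rewrite ftake_ge.
rewrite -{2}[g](@ftake_ge (flen g)) //.
have a0 : syllable := (true, 0).
have H i : (k <= i <= flen g)%N -> Q (ftake k g) <-> Q (ftake i g).
  elim: i => [|i IH]; first by rewrite leqn0 => /andP[/eqP -> _].
  rewrite leq_eqVlt ltnS => /andP[/orP[/eqP -> //|ki] ig].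
  rewrite IH ?ki ?(ltnW ig) // (ftakeS a0) //.
  by apply: QD; apply: Dg; rewrite ki.
by apply: H; rewrite (ltnW kg) leqnn.
Qed.

End FreeProductWords.

(** * Coarse cuts and their shadows *)

Section CoarseGraph.
Variables (X : Type) (E : X -> X -> Prop).

Fixpoint reach (r : nat) (x y : X) : Prop :=
  if r is r'.+1 then exists2 z, E x z & reach r' z y else x = y.

(** The coboundary is only asked to be bounded: with infinite valence it may contain infinitely many
    edges. *)
Definition cut_at (R : nat) (x : X) (C : set X) : Prop :=
  forall y z, E y z -> ~ reach R x y -> (C y <-> C z).

Definition cut (C : set X) : Prop := exists R x, cut_at R x C.

(** Sequences model the ends: being eventually decided by every cut is exactly what makes shadows
    commute with complements, and no topology on the ends is required. *)
Definition convergent (u : nat -> X) : Prop :=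
  (forall R x, exists n0, forall n, (n0 <= n)%N -> ~ reach R x (u n)) /\
  (forall C, cut C -> exists n0, (forall n, (n0 <= n)%N -> C (u n)) \/
                                 (forall n, (n0 <= n)%N -> ~ C (u n))).

(* Equivalent sequences are not identified: only the sets [shadow C] below
   matter, and they do not distinguish equivalent sequences. *)
Record boundary : Type :=
  BoundaryPt { seq_of :> nat -> X; seq_ofP : convergent seq_of }.

Definition shadow (C : set X) : set boundary :=
  [set u : boundary | exists n0, forall n, (n0 <= n)%N -> C (u n)].

Definition clopen_shadow : set (set boundary) :=
  [set W | exists2 C, cut C & W = shadow C].

(** The centre is free and the radius fixed, so this family is invariant under all automorphisms;
    its members are the cuts counted first. *)
Definition radius_shadow (R : nat) : set (set boundary) :=
  [set W | exists C x, cut_at R x C /\ W = shadow C].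

Hypothesis (Erefl : forall x, E x x) (Esym : forall x y, E x y -> E y x).

Lemma reach_le r s x y : (r <= s)%N -> reach r x y -> reach s x y.
Proof.
elim: r s x => [|r IH] s x rs /=.
  by move=> <-; elim: s {rs} => //= s IH; exists x.
by case: s rs => // s rs [z xz zy]; exists z => //; apply: IH zy.
Qed.

Lemma reachD r s x y z : reach r x y -> reach s y z -> reach (r + s) x z.
Proof.
elim: r x => [|r IH] x /=; first by move=> ->.
by move=> [t xt ty] yz; exists t => //; apply: IH.
Qed.

Lemma reach_sym r x y : reach r x y -> reach r y x.
Proof.
elim: r x y => [|r IH] x y /=; first by [].
move=> [z xz zy]; have : reach (r + 1) y x.
  by apply: reachD (IH _ _ zy) _; exists x => //; apply: Esym.
by rewrite addn1.
Qed.

Lemma cut_at_reach R x C r y z : cut_at R x C -> reach r y z ->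
  ~ reach (R + r) x y -> (C y <-> C z).
Proof.
move=> cC; elim: r y => [|r IH] y /=; first by move=> ->.
move=> [t yt tz] xy; rewrite (cC _ _ yt); last first.
  by move=> h; apply: xy; apply: reach_le h; rewrite leq_addr.
apply: IH => // xt; apply: xy; rewrite addnS -addn1.
by apply: reachD xt _; exists y => //; apply: Esym.
Qed.

Lemma cut_at_le R R' x x' C r : reach r x x' -> (R + r <= R')%N ->
  cut_at R x C -> cut_at R' x' C.
Proof.
move=> xx' rR cC y z yz h; apply: cC => // xy; apply: h.
apply: reach_le rR _; rewrite addnC; apply: reachD xy; exact: reach_sym.
Qed.

Lemma cut_atC R x C : cut_at R x C -> cut_at R x (~` C).
Proof. by move=> cC y z yz h; split=> + /(cC _ _ yz h). Qed.

Lemma cut_atI R x C C' : cut_at R x C -> cut_at R x C' ->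
  cut_at R x (C `&` C').
Proof.
move=> cC cC' y z yz h.
by split=> -[] /(cC _ _ yz h) ? /(cC' _ _ yz h) ?.
Qed.

Lemma cutC C : cut C -> cut (~` C).
Proof. by move=> [R [x cC]]; exists R, x; apply: cut_atC. Qed.

Hypothesis Econ : forall x y, exists r, reach r x y.

Lemma cut_base C x : cut C -> exists R, cut_at R x C.
Proof.
move=> [R [x' cC]]; have [r xx'] := Econ x' x.
by exists (R + r)%N; apply: cut_at_le xx' _ cC.
Qed.

Lemma cutI C C' : cut C -> cut C' -> cut (C `&` C').
Proof.
move=> [R [x cC]] /(cut_base x) [R' cC'].
exists (maxn R R'), x; apply: cut_atI.
  by apply: (@cut_at_le R _ x x C 0); rewrite ?addn0 ?leq_maxl.
by apply: (@cut_at_le R' _ x x C' 0); rewrite ?addn0 ?leq_maxr.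
Qed.

Lemma shadowI C C' : shadow (C `&` C') = shadow C `&` shadow C'.
Proof.
apply/seteqP; split=> u.
  by move=> [n h]; split; exists n => m /h [].
move=> [[n h] [n' h']]; exists (maxn n n') => m.
by rewrite geq_max => /andP[/h ? /h' ?].
Qed.

Lemma shadowC C : cut C -> shadow (~` C) = ~` shadow C.
Proof.
move=> cC; apply/seteqP; split=> u.
  by move=> [n h] [n' h']; apply: (h _ (leq_maxl n n')); apply/h'/leq_maxr.
by move=> nu; have [n [h|h]] := (seq_ofP u).2 _ cC; [case: nu|]; exists n.
Qed.

Lemma clopen_shadowC W : clopen_shadow W -> clopen_shadow (~` W).
Proof. by move=> [C cC ->]; exists (~` C); rewrite ?shadowC //; apply: cutC. Qed.

Lemma clopen_shadowI W W' : clopen_shadow W -> clopen_shadow W' ->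
  clopen_shadow (W `&` W').
Proof.
move=> [C cC ->] [C' cC' ->].
by exists (C `&` C'); rewrite ?shadowI //; apply: cutI.
Qed.

Lemma radius_clopen R W : radius_shadow R W -> clopen_shadow W.
Proof. by move=> [C [x [cC ->]]]; exists C => //; exists R, x. Qed.

Lemma boundary_eq (u v : boundary) : seq_of u = seq_of v -> u = v.
Proof.
case: u v => [u cu] [v cv] /= uv; subst v; congr BoundaryPt.
exact: Prop_irrelevance.
Qed.

Record graph_aut : Type := GraphAut {
  aut_fun :> X -> X;
  aut_inv : X -> X;
  aut_funK : cancel aut_fun aut_inv;
  aut_invK : cancel aut_inv aut_fun;
  aut_funE : forall x y, E x y -> E (aut_fun x) (aut_fun y);
  aut_invE : forall x y, E x y -> E (aut_inv x) (aut_inv y)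
}.

Definition aut_sym (a : graph_aut) : graph_aut :=
  GraphAut (aut_invK a) (aut_funK a) (aut_invE a) (aut_funE a).

Lemma reach_aut (a : graph_aut) r x y : reach r x y -> reach r (a x) (a y).
Proof.
elim: r x => [|r IH] x /=; first by move=> ->.
by move=> [z xz zy]; exists (a z); [apply: aut_funE | apply: IH].
Qed.

Lemma cut_at_preimage (a : graph_aut) R x C :
  cut_at R x C -> cut_at R (aut_inv a x) (a @^-1` C).
Proof.
move=> cC y z yz h; apply: cC; first exact: aut_funE.
move=> /(reach_aut (aut_sym a)) /=; rewrite aut_funK; exact: h.
Qed.

Lemma cut_preimage (a : graph_aut) C : cut C -> cut (a @^-1` C).
Proof.
by move=> [R [x cC]]; exists R, (aut_inv a x); apply: cut_at_preimage.
Qed.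

Lemma convergent_aut (a : graph_aut) (u : boundary) : convergent (fun n => a (u n)).
Proof.
split=> [R x|C /(cut_preimage a) cC].
  have [n0 H] := (seq_ofP u).1 R (aut_inv a x); exists n0 => n /H nu.
  by move=> /(reach_aut (aut_sym a)) /=; rewrite aut_funK; exact: nu.
by have [n0 H] := (seq_ofP u).2 _ cC; exists n0.
Qed.

Definition bmap (a : graph_aut) (u : boundary) : boundary :=
  BoundaryPt (convergent_aut a u).

Lemma bmapK (a : graph_aut) : cancel (bmap a) (bmap (aut_sym a)).
Proof.
by move=> u; apply: boundary_eq; apply/funext => n /=; rewrite aut_funK.
Qed.

Lemma bmapVK (a : graph_aut) : cancel (bmap (aut_sym a)) (bmap a).
Proof.
by move=> u; apply: boundary_eq; apply/funext => n /=; rewrite aut_invK.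
Qed.

Lemma radius_shadow_aut (a : graph_aut) R W :
  radius_shadow R W -> radius_shadow R (bmap a @^-1` W).
Proof.
move=> [C [x [cC ->]]]; exists (a @^-1` C), (aut_inv a x); split=> //.
exact: cut_at_preimage.
Qed.

Lemma clopen_shadow_aut (a : graph_aut) W :
  clopen_shadow W -> clopen_shadow (bmap a @^-1` W).
Proof.
by move=> [C cC ->]; exists (a @^-1` C) => //; apply: cut_preimage.
Qed.

End CoarseGraph.

(** * Cones of a lattice *)

Definition crosses (T : Type) (A B : set T) : Prop :=
  [/\ A `&` B !=set0, A `&` ~` B !=set0, ~` A `&` B !=set0
    & ~` A `&` ~` B !=set0].

Section Lattice.
Local Open Scope group_scope.
Variable p : nat.
Local Notation G := (free_product p).
Implicit Types g h w : G.
Variables (X : Type) (E : X -> X -> Prop).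
Local Notation reach := (reach E).
Local Notation cut_at := (cut_at E).
Local Notation cut := (cut E).
Local Notation boundary := (boundary E).

Variables (act : G -> X -> X) (x0 : X) (D : nat) (ell : nat -> nat) (kap : nat).

(** A geometric action in quantitative form: the orbit of [x0] is [D]-dense, [ell] turns graph
    distance into a bound on syllable length, and [kap] bounds the displacement by one syllable. *)
Record lattice_action : Prop := LatticeAction {
  lat_refl : forall x, E x x;
  lat_sym : forall x y, E x y -> E y x;
  lat_con : forall x y, exists r, reach r x y;
  lat_act1 : forall x, act 1%g x = x;
  lat_actM : forall g h x, act (g * h)%g x = act g (act h x);
  lat_actE : forall g x y, E x y -> E (act g x) (act g y);
  lat_dense : forall x, exists g, reach D (act g x0) x;
  lat_proper : forall r g, reach r x0 (act g x0) -> (flen g <= ell r)%N;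
  lat_syl : forall a, reach kap x0 (act (syl a) x0)
}.

Hypothesis Hlat : lattice_action.

Let Erefl := lat_refl Hlat.
Let Esym := lat_sym Hlat.
Let Econ := lat_con Hlat.
Local Notation ptG g := (act g x0).

Lemma reach_act r g x y : reach r x y -> reach r (act g x) (act g y).
Proof.
elim: r x => [|r IH] x /=; first by move=> ->.
by move=> [z xz zy]; exists (act g z); [apply: lat_actE | apply: IH].
Qed.

Lemma actKg g x : act g^-1 (act g x) = x.
Proof. by rewrite -lat_actM // mulVg lat_act1. Qed.

Lemma actVKg g x : act g (act g^-1 x) = x.
Proof. by rewrite -lat_actM // mulgV lat_act1. Qed.

Lemma reach_actV r g x y : reach r (act g x) y -> reach r x (act g^-1 y).
Proof. by move=> /(reach_act g^-1); rewrite actKg. Qed.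

Lemma orb_len r g h : reach r (ptG g) (ptG h) -> (flen (g^-1 * h)%g <= ell r)%N.
Proof. by move=> /reach_actV; rewrite -lat_actM //; apply: lat_proper. Qed.

Lemma len_orb1 g : reach (kap * flen g) x0 (ptG g).
Proof.
have a0 : syllable p := (true, 0%R).
have H i : (i <= flen g)%N -> reach (kap * i) x0 (ptG (ftake i g)).
  elim: i => [_|i IH ig].
    by rewrite muln0 /= (_ : ftake 0 g = 1%g) ?lat_act1 //; apply: val_inj; rewrite /= take0.
  rewrite (ftakeS a0) // lat_actM // mulnS addnC.
  by apply: (reachD (IH (ltnW ig))); apply/reach_act/lat_syl.
by have := H _ (leqnn _); rewrite ftake_ge.
Qed.

Lemma len_orb m g h : (flen (g^-1 * h)%g <= m)%N -> reach (kap * m) (ptG g) (ptG h).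
Proof.
move=> ghm; have := reach_act g (len_orb1 (g^-1 * h)%g).
rewrite -lat_actM // mulVKg; apply: reach_le => //.
by rewrite leq_mul2l ghm orbT.
Qed.

(** The trace of a cut on the orbit. In [cut_local] the bound m depends on the radius only, wherever
    the centre is; [cut_local1] recentres at 1 and loses this uniformity. *)
Definition local_at (C : set X) (g0 : G) (m : nat) : Prop :=
  forall g a, (m < flen (g0^-1 * g)%g)%N -> (C (ptG g) <-> C (ptG (g * syl a)%g)).

Lemma cut_local R x C : cut_at R x C -> exists g0, local_at C g0 (ell (D + (R + kap))).
Proof.
move=> cC; have [g0 g0x] := lat_dense Hlat x; exists g0 => g a lg.
apply: (cut_at_reach Erefl Esym cC (r := kap)).
  by rewrite lat_actM //; apply/reach_act/lat_syl.
move=> xg; have := orb_len (reachD g0x xg).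
by rewrite leqNgt lg.
Qed.

Lemma cut_local1 C : cut C -> exists m, local_at C 1%g m.
Proof.
move=> [R [x cC]]; have [g0 H] := cut_local cC.
exists (flen g0 + ell (D + (R + kap)))%N => g a lg; apply: H.
by have := flen_sub g0 g; rewrite invg1 mul1g in lg; lia.
Qed.

Lemma local_ext C g0 m k g : local_at C g0 m -> (m + flen g0 < k)%N ->
  C (ptG (ftake k g)) <-> C (ptG g).
Proof.
move=> lC mk; apply: (@ftake_const p (fun g => C (ptG g))
  [set h | m < flen (g0^-1 * h)%g]%N) => [h a|i /andP[ki ig]].
  exact: lC.
have := flen_sub g0 (ftake i g); rewrite (flen_take (ltnW ig)) /mkset; lia.
Qed.

Lemma cut_reach_orb C r : cut C ->
  exists N, forall x g, reach r x (ptG g) -> (N <= flen g)%N -> (C x <-> C (ptG g)).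
Proof.
move=> /(cut_base Erefl Esym Econ x0) [R cC].
exists (ell (R + r + r)).+1 => x g xg lg; apply: (cut_at_reach Erefl Esym cC xg) => h.
have := reachD h xg => /(lat_proper Hlat); lia.
Qed.

(** Inclusion of shadows can be tested on long orbit points: a sequence leaving every ball stays
    within [D] of orbit points of growing length, and far out a cut does not separate points at
    distance [D]. *)
Lemma shadow_sub C C' : cut C -> cut C' ->
  (exists N, forall g, (N <= flen g)%N -> C (ptG g) -> C' (ptG g)) ->
  shadow (E := E) C `<=` shadow C'.
Proof.
move=> cC cC' [N CC'] u [n Cu].
have [N1 H1] := cut_reach_orb D cC; have [N2 H2] := cut_reach_orb D cC'.
have [n0 Hn0] := (seq_ofP u).1 (kap * (N + N1 + N2) + D)%N x0.
exists (maxn n n0) => m; rewrite geq_max => /andP[/Cu Cum /Hn0 um].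
have [g gx] := lat_dense Hlat (u m).
have lg : (N + N1 + N2 < flen g)%N.
  rewrite ltnNge; apply/negP => lg; apply: um; apply: reachD gx.
  apply: reach_le (len_orb1 g) => //; by rewrite leq_mul2l lg orbT.
move/(reach_sym Esym): gx => gx.
apply/(H2 _ _ gx); first by lia.
by apply: CC'; [lia | apply/(H1 _ _ gx) => //; lia].
Qed.

Fixpoint altword (s : bool) (n : nat) : seq (syllable p) :=
  if n is n'.+1 then (s, 1%R) :: altword (~~ s) n' else [::].

Lemma size_altword s n : size (altword s n) = n.
Proof. by elim: n s => //= n IH s; rewrite IH. Qed.

Lemma take_altword s m n : (m <= n)%N -> take m (altword s n) = altword s m.
Proof. by elim: m n s => [|m IH] [|n] s //= mn; rewrite IH. Qed.

Lemma altword_alternating s n : alternating (altword s n).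
Proof.
elim: n s => //= n IH s; rewrite alternating_cons IH GRing.oner_eq0 /= andbT.
by case: n {IH} => //= n; case: s.
Qed.

Lemma extend_alternating w n :
  alternating (w ++ altword (~~ (last (true, 0%R) w).1) n).
Proof.
case/lastP: (syl_of w) (syl_ofP w) => [_|u a ru]; first exact: altword_alternating.
rewrite last_rcons; case: n => [|n] /=; first by rewrite cats0.
rewrite alternating_join ru -/(altword _ n.+1) altword_alternating /=.
by case: (a.1).
Qed.

(** An explicit end below w: syllables 1 are appended, alternately in the two factors, beginning
    with the factor in which w does not end. *)
Definition ray w n : G := FreeProduct (extend_alternating w n).

Lemma flen_ray w n : flen (ray w n) = (flen w + n)%N.
Proof. by rewrite /flen /= size_cat size_altword. Qed.

Lemma ftake_ray w k n : (k <= n)%N -> ftake k (ray w n) = ftake k (ray w k).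
Proof.
move=> kn; apply: val_inj => /=; rewrite !take_cat; case: ifP => // _.
by congr (_ ++ _); rewrite !take_altword //; lia.
Qed.

Lemma prefix_ray w n : prefix w (ray w n).
Proof. exact: prefix_prefix. Qed.

Lemma ray_convergent w : convergent E (fun n => ptG (ray w n)).
Proof.
split=> [R x|C cC].
  have [r rx] := Econ x0 x; exists (ell (r + R)).+1 => n nl h.
  have := lat_proper Hlat (reachD rx h); rewrite flen_ray; lia.
have [m lC] := cut_local1 cC; exists m.+1.
have H n : (m < n)%N -> C (ptG (ray w n)) <-> C (ptG (ftake m.+1 (ray w m.+1))).
  by move=> mn; rewrite -(local_ext _ lC (k := m.+1)) ?addn0 // ftake_ray.
have [Cm|Cm] := pselect (C (ptG (ftake m.+1 (ray w m.+1)))); [left|right] => n mn.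
  exact/H.
by move/H: Cm; apply.
Qed.

Definition ray_pt w : boundary := BoundaryPt (ray_convergent w).

Lemma shadow_meet w C :
  (exists N, forall g, (N <= flen g)%N -> prefix w g -> C (ptG g)) ->
  shadow (E := E) C (ray_pt w).
Proof.
move=> [N CN]; exists N => n nN; apply: CN; last exact: prefix_ray.
by rewrite flen_ray; lia.
Qed.

(** Without such a w, [shadow_sub] would place the shadow inside that of the empty set; and by
    [local_ext] one long orbit point in [C] brings along all those with the same long prefix. *)
Lemma shadow_point C : cut C -> shadow (E := E) C !=set0 ->
  exists m, forall N, (m <= N)%N ->
    exists w, flen w = N /\ forall g, prefix w g -> C (ptG g).
Proof.
move=> cC [u Cu]; have [m lC] := cut_local1 cC.
exists m.+1 => N mN; apply: contrapT => nw.
suff : shadow (E := E) C `<=` shadow set0 by move=> /(_ _ Cu) [n /(_ _ (leqnn n))].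
apply: shadow_sub => //; first by exists 0%N, x0.
exists N => g Ng Cg; case: nw; exists (ftake N g); rewrite flen_take //; split=> //.
move=> h; rewrite prefix_ftakeP flen_take // => /eqP e.
rewrite -(local_ext _ lC (k := N)); last by rewrite addn0.
by rewrite e (local_ext _ lC) // addn0.
Qed.

Definition coneX w : set X := [set x | exists2 g : G, prefix w g & reach D (ptG g) x].

Definition cone w : set boundary := shadow (coneX w).

(** An edge leaving [coneX w] joins points within [D] of orbit points of g and h, so g^-1 h has at
    most [ell (D + (1 + D))] syllables, and so has w^-1 g by [flen_prefixl]. The final 1 covers the
    other endpoint. The radius is the same for all w. *)
Definition cone_radius : nat := (kap * ell (D + (1 + D)) + D + 1)%N.

Lemma reach1 x y : E x y -> reach 1 x y.
Proof. by move=> xy; exists y. Qed.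

Lemma coneX_cut w : (0 < flen w)%N -> cut_at cone_radius (ptG w) (coneX w).
Proof.
move=> w0.
have H y z : E y z -> coneX w y -> ~ coneX w z ->
    reach (kap * ell (D + (1 + D)) + D) (ptG w) y.
  move=> yz [g wg gy] nz; have [h hz] := lat_dense Hlat z.
  have wh : ~~ prefix w h by apply/negP => wh; apply: nz; exists h.
  apply: (reachD _ gy); apply: len_orb; apply: leq_trans (flen_prefixl w0 wg wh) _.
  apply: orb_len; apply: (reachD gy); apply: reachD (reach1 yz) _.
  exact: reach_sym.
move=> y z yz h; split=> cw; apply: contrapT => nc; apply: h.
  by apply: reach_le (H _ _ yz cw nc); rewrite // leq_addr.
apply: reachD (H _ _ (Esym yz) cw nc) _; exact/reach1/Esym.
Qed.

Lemma cut_coneX w : (0 < flen w)%N -> cut (coneX w).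
Proof. by move=> w0; exists cone_radius, (ptG w); apply: coneX_cut. Qed.

Lemma cone_radius_shadow w : (0 < flen w)%N -> radius_shadow cone_radius (cone w).
Proof. by move=> w0; exists (coneX w), (ptG w); split=> //; apply: coneX_cut. Qed.

Lemma coneX_long w : (0 < flen w)%N ->
  exists N, forall g, (N <= flen g)%N -> (coneX w (ptG g) <-> prefix w g).
Proof.
move=> w0; exists (flen w + ell D).+1 => g lg; split; last first.
  move=> wg; exists g => //; have := reach_le Erefl (leq0n D); exact.
move=> [h wh hg]; apply: contrapT => /negP nwg.
have := flen_prefix w0 wh nwg; have := orb_len hg; have := flen_sub w g; lia.
Qed.

Lemma cone_sub w C : (0 < flen w)%N -> cut C ->
  (exists N, forall g, (N <= flen g)%N -> prefix w g -> C (ptG g)) ->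
  cone w `<=` shadow C.
Proof.
move=> w0 cC [N CN]; apply: shadow_sub => //; first exact: cut_coneX.
have [N' H] := coneX_long w0; exists (maxn N N') => g.
by rewrite geq_max => /andP[/CN Cg /H wg] /wg /Cg.
Qed.

Lemma cone_subC w C : (0 < flen w)%N -> cut C ->
  (exists N, forall g, (N <= flen g)%N -> ~~ prefix w g -> C (ptG g)) ->
  ~` cone w `<=` shadow C.
Proof.
move=> w0 cC [N CN]; rewrite -shadowC; last exact: cut_coneX.
apply: shadow_sub => //; first exact/cutC/cut_coneX.
have [N' H] := coneX_long w0; exists (maxn N N') => g.
rewrite geq_max => /andP[/CN Cg /H wg] h; apply: Cg; apply/negP => /wg; exact: h.
Qed.

Lemma cone_ray w : (0 < flen w)%N -> cone w (ray_pt w).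
Proof.
move=> w0; apply: shadow_meet; have [N H] := coneX_long w0.
by exists N => g Ng wg; apply/H.
Qed.

Lemma cone_le w w' : (0 < flen w)%N -> prefix w w' -> cone w' `<=` cone w.
Proof.
move=> w0 ww'; have w'0 : (0 < flen w')%N.
  by apply: leq_trans w0 _; apply: size_prefix.
apply: cone_sub => //; first exact: cut_coneX.
have [N H] := coneX_long w0; exists N => g Ng w'g; apply/H => //.
exact: prefix_trans ww' w'g.
Qed.

Definition constant_on (W Z : set boundary) : Prop := Z `<=` W \/ Z `<=` ~` W.

Lemma clopen_constant W : clopen_shadow W ->
  exists N, forall n w, (N <= n)%N -> flen w = n -> constant_on W (cone w).
Proof.
move=> [C cC ->]; have [m lC] := cut_local1 cC.
exists m.+1 => n w mn wn; have w0 : (0 < flen w)%N by lia.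
have H g : prefix w g -> C (ptG g) <-> C (ptG w).
  by move/ftake_prefix => <-; rewrite (local_ext _ lC) // addn0 wn.
have [Cw|Cw] := pselect (C (ptG w)); [left|right; rewrite -shadowC //].
  by apply: cone_sub => //; exists 0%N => g _ /H ->.
apply: cone_sub => //; first exact: cutC.
by exists 0%N => g _ wg /(H _ wg).
Qed.

(** Compactness at a finite level: there are finitely many words of length M, so a sequence outside
    all their cones would from some index on avoid all of them at once, although every far point is
    near an orbit point with a prefix of length M. *)
Lemma cone_cover M (u : boundary) : (0 < M)%N -> exists w, flen w = M /\ cone w u.
Proof.
move=> M0; apply: contrapT => nu.
have {}nu (t : M.-tuple (syllable p)) :
    exists n0, forall w, syl_of w = t -> forall n, (n0 <= n)%N -> ~ coneX w (u n).
  have [[w wt]|nw] := pselect (exists w, syl_of w = t); last first.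
    by exists 0%N => w wt; case: nw; exists w.
  have wM : flen w = M by rewrite /flen wt size_tuple.
  have [|n [h|h]] := (seq_ofP u).2 (coneX w); first by apply: cut_coneX; rewrite wM.
    by case: nu; exists w; split => //; exists n.
  by exists n => w' w't; rewrite (_ : w' = w) //; apply: val_inj; rewrite /= w't wt.
have [f fP] := choice nu.
have [n0 Hn0] := (seq_ofP u).1 (kap * M + D)%N x0.
pose n := maxn n0 (\max_t f t).
have [g gx] := lat_dense Hlat (u n).
have lg : (M < flen g)%N.
  rewrite ltnNge; apply/negP => lg; apply: (Hn0 n); first exact: leq_maxl.
  apply: reachD gx; apply: reach_le (len_orb1 g) => //.
  by rewrite leq_mul2l lg orbT.
have sz : size (ftake M g) == M by apply/eqP; apply: flen_take; exact: ltnW.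
apply: (fP (Tuple sz) (ftake M g) erefl n).
  by apply: leq_trans (leq_bigmax (Tuple sz)) _; apply: leq_maxr.
exists g => //; exact: prefix_ftake.
Qed.

(** Such a set is the union of the cones it contains, hence is determined by a set of [M]-tuples of
    syllables. *)
Lemma finite_constant M : (0 < M)%N ->
  finite_set [set W : set boundary | forall w, flen w = M -> constant_on W (cone w)].
Proof.
move=> M0.
pose F (t : {set M.-tuple (syllable p)}) : set boundary :=
  [set u | exists2 w, exists2 s, s \in t & syl_of w = s & cone w u].
apply: (@sub_finite_set _ _ (F @` setT)); last exact: finite_image.
move=> W HW.
exists [set s | `[< exists2 w, syl_of w = tval s & cone w `<=` W >]]%SET => //.
apply/seteqP; split=> u.
  move=> [w [s]]; rewrite inE => /asboolP[w' w's w'W] ws wu; apply: w'W.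
  by rewrite (_ : w' = w) //; apply: val_inj; rewrite /= w's ws.
move=> Wu; have [w [wM wu]] := cone_cover u M0.
exists w => //; have sz : size w == M by apply/eqP.
exists (Tuple sz) => //; rewrite inE; apply/asboolP; exists w => //.
by case: (HW _ wM) => // h; have := h _ wu Wu.
Qed.

Definition lact g : graph_aut E.
Proof.
refine (@GraphAut X E (act g) (act g^-1) (actKg g) (actVKg g) _ _);
  by move=> *; apply: lat_actE.
Defined.

Lemma bmap1 u : bmap (lact 1) u = u.
Proof. by apply: boundary_eq; apply/funext => n /=; rewrite lat_act1. Qed.

Lemma bmapM g h u : bmap (lact (g * h)) u = bmap (lact g) (bmap (lact h) u).
Proof. by apply: boundary_eq; apply/funext => n /=; rewrite lat_actM. Qed.

(** Since w^-1 h starts in the factor in which w ends, a syllable of the other factor fits between w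
    and w^-1 h without cancellation. *)
Lemma prefix_pingpong w h : (0 < flen w)%N -> ~~ prefix w h ->
  prefix w (w * syl (~~ (last (true, 0%R) w).1, 1%R) * (w^-1 * h)).
Proof.
move=> w0 wh; rewrite -mulgA.
rewrite [X in prefix _ X](_ : _ =
  smul w (spush (~~ (last (true, 0%R) w).1, 1%R) (smul (sinv w) h))); last first.
  rewrite -[LHS]/(smul w (smul (spush _ [::]) (smul (sinv w) h))).
  by congr smul; rewrite {1}/spush /= GRing.oner_eq0.
move: w0 wh; rewrite /flen.
case/lastP: (syl_of w) (syl_ofP w) => // u a rw _ wh.
have [c [t [e ca]]] := head_smulV rw (syl_ofP h) wh.
have rct : alternating (c :: t).
  by rewrite -e; apply: smul_alternating; apply: syl_ofP.
rewrite e last_rcons spush_cons; last first.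
  by rewrite alternating_cons rct GRing.oner_eq0 /= ca; case: (a.1).
rewrite smul_alt ?prefix_prefix // alternating_join rw.
rewrite alternating_cons rct GRing.oner_eq0 /= ca.
by case: (a.1).
Qed.

(** A nonempty clopen set contains the end of a whole cone, and conjugating by w a syllable of the
    factor in which w does not end pushes everything outside that cone into it. *)
Lemma expanding W : clopen_shadow W -> W !=set0 ->
  exists g, ~` W `<=` bmap (lact g) @^-1` W.
Proof.
move=> [C cC ->] /(shadow_point cC) [m /(_ m.+1 (leqnSn m)) [w [wm Cw]]].
have w0 : (0 < flen w)%N by rewrite wm.
set g := w * syl (~~ (last (true, 0%R) w).1, 1%R) * w^-1.
exists g; rewrite -shadowC //.
apply: (@shadow_sub _ (lact g @^-1` C)); [exact: cutC|exact: cut_preimage|].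
exists 0%N => h _ nC; rewrite /preimage /mkset /= -lat_actM //; apply: (Cw).
rewrite -mulgA; apply: prefix_pingpong => //.
by apply/negP => /Cw.
Qed.

(** If the centre g0 of F is short, F is constant on all long cones. If it is long, F is constant
    off the cone of the first N syllables of g0, while W is constant on that cone; one of the four
    corners is then empty and F does not cross W. *)
Lemma crossing_constant R W : clopen_shadow W -> exists2 M, (0 < M)%N &
  forall F, radius_shadow R F -> crosses F W ->
    forall w, flen w = M -> constant_on F (cone w).
Proof.
move=> cW; have [N0 HN] := clopen_constant cW; pose N := N0.+1.
pose m := ell (D + (R + kap)).
exists (N + m + m).+2 => // F [C [x [cC ->]]] [FW FnW nFW nFnW] w wM.
have kC : cut C by exists R, x.
have w0 : (0 < flen w)%N by rewrite wM.
have [g0 lC] := cut_local cC; rewrite -/m in lC.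
have [lg|lg] := leqP (flen g0) (N + m).+1.
  have H g : prefix w g -> C (ptG g) <-> C (ptG w).
    move/ftake_prefix => <-; rewrite (local_ext _ lC) // wM; lia.
  have [Cw|Cw] := pselect (C (ptG w)); [left|right; rewrite -shadowC //].
    by apply: cone_sub => //; exists 0%N => g _ wg; apply/(H _ wg).
  apply: cone_sub => //; first exact: cutC.
  by exists 0%N => g _ wg /(H _ wg).
have z0 : flen (ftake N g0) = N by rewrite flen_take //; lia.
have z0' : (0 < flen (ftake N g0))%N by rewrite z0.
have H g : ~~ prefix (ftake N g0) g -> C (ptG g) <-> C (ptG 1).
  move=> ng; rewrite (_ : 1 = ftake 0 g); last by apply: val_inj; rewrite /= take0.
  symmetry; apply: (@ftake_const p (fun g => C (ptG g))
    [set h | m < flen (g0^-1 * h)%g]%N) => [h a|i _]; first exact: lC.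
  rewrite /mkset.
  have nh : ~~ prefix (ftake N g0) (ftake i g).
    apply: contra ng => h; apply: prefix_trans h _; exact: prefix_ftake.
  have := flen_prefixl z0' (prefix_ftake N g0) nh.
  have := flen_sub (ftake N g0) g0; rewrite z0; lia.
have cF : constant_on (shadow C) (~` cone (ftake N g0)).
  have [C1|C1] := pselect (C (ptG 1)); [left|right; rewrite -shadowC //].
    by apply: cone_subC => //; exists 0%N => g _ wg; apply/(H _ wg).
  apply: cone_subC => //; first exact: cutC.
  by exists 0%N => g _ wg /(H _ wg).
exfalso; have [zW|zW] := HN N _ (leqnSn _) z0.
  have [h|h] := cF.
    by have [u [nFu nWu]] := nFnW; apply: nFu; apply: h => /zW.
  by have [u [Fu nWu]] := FnW; apply: (h u) => // /zW.
have [h|h] := cF.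
  by have [u [nFu Wu]] := nFW; apply: nFu; apply: h => /zW; apply.
by have [u [Fu Wu]] := FW; apply: (h u) => // /zW; apply.
Qed.

Lemma finite_crossing R W : clopen_shadow W ->
  finite_set [set F : set boundary | radius_shadow R F /\ crosses F W].
Proof.
move=> /(crossing_constant R) [M M0 H]; apply: sub_finite_set (finite_constant M0).
by move=> F [rF cF] w wM; apply: H.
Qed.

Hypothesis two_neq0 : (2%:R : 'F_p)%R != 0%R.

Lemma cone_disjoint w u : (0 < flen w)%N -> (flen w <= flen u)%N ->
  ~~ prefix w u -> cone u `<=` ~` cone w.
Proof.
move=> w0 wu nwu; rewrite -shadowC; last exact: cut_coneX.
have u0 : (0 < flen u)%N by apply: leq_trans wu.
apply: cone_sub => //; first exact/cutC/cut_coneX.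
have [N H] := coneX_long w0; exists N => g Ng ug /(H g Ng).1 wg.
move: nwu; rewrite prefix_ftakeP -(ftake_prefix ug) ftake_take //.
by rewrite (ftake_prefix wg) eqxx.
Qed.

Lemma cone_clopen w : (0 < flen w)%N -> clopen_shadow (cone w).
Proof. by move=> w0; apply: radius_clopen; apply: cone_radius_shadow. Qed.

Lemma nontrivial_clopen : exists W : set boundary,
  [/\ clopen_shadow W, W !=set0 & ~` W !=set0].
Proof.
pose a s : G := syl (s, 1%R).
have ea s : syl_of (a s) = [:: (s, 1%R)] by [].
have la s : flen (a s) = 1%N by rewrite /flen ea.
have a0 s : (0 < flen (a s))%N by rewrite la.
exists (cone (a true)); split; first exact: cone_clopen.
  by exists (ray_pt (a true)); apply: cone_ray.
exists (ray_pt (a false)); apply: (cone_disjoint (a0 _)) (cone_ray (a0 false)).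
  by rewrite !la.
by rewrite !ea.
Qed.

(** Changing the last syllable (s, x) of w' into (s, -x), a different one as 2 is invertible, gives
    a word u still below w; its ray lies in the cone of w but not in that of w'. *)
Lemma cone_neq w w' : (0 < flen w)%N -> prefix w w' -> (flen w < flen w')%N ->
  cone w <> cone w'.
Proof.
move=> w0 ww' lw e.
have w'0 : (0 < flen w')%N by apply: leq_trans lw.
have [u [wu lu w'u]] : exists u : G,
    [/\ prefix w u, flen u = flen w' & ~~ prefix w' u].
  move: w'0 lw ww'; rewrite /flen.
  case/lastP: (syl_of w') (syl_ofP w') => // v [s x] rv _.
  rewrite size_rcons ltnS => lw wv.
  have [xn0 rv'] : x != 0%R /\ alternating (rcons v (s, - x)%R).
    case/lastP: v rv {lw wv} => [|v b] rv.
      by move: rv; rewrite /= !alternating_cons /= GRing.oppr_eq0 !andbT.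
    move: rv; rewrite -!(cats1 (rcons v b)) !alternating_join.
    by rewrite !alternating_cons /= GRing.oppr_eq0 => /and3P[-> /andP[-> _] ->].
  exists (FreeProduct rv'); split; rewrite /= ?size_rcons //.
    by move: wv; rewrite !prefixE -!cats1 !takel_cat.
  rewrite prefixE take_oversize ?size_rcons // eqseq_rcons eqxx /=.
  rewrite xpair_eqE eqxx /= eq_sym -GRing.addr_eq0.
  by rewrite -GRing.mulr2n -GRing.mulr_natl GRing.mulf_neq0.
have u0 : (0 < flen u)%N by rewrite lu.
have := cone_disjoint w'0 (eq_leq (esym lu)) w'u.
rewrite -e => /(_ _ (cone_ray u0)); apply.
exact: (cone_le w0 wu (cone_ray u0)).
Qed.

(* If V splits the cone of w, it also splits, and hence crosses, the cones of all
   prefixes of w longer than a bound depending on W. *)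
Lemma few_crossings R (k : nat) W : (cone_radius <= R)%N -> clopen_shadow W ->
  finite_set [set V : set boundary | crosses V W /\
    exists s : seq (set boundary), (size s <= k)%N /\
      forall F, radius_shadow R F -> crosses F V -> F \in s].
Proof.
move=> hR cW; have [N0 HN] := clopen_constant cW; pose N := N0.+1.
apply: (@sub_finite_set _ _ _ _ (@finite_constant (N + k) _)); last by rewrite addSn.
move=> V [VW [s [sk Hs]]] w wM; apply: contrapT => nc.
have Np i : (i <= k)%N -> flen (ftake (N + i) w) = (N + i)%N.
  by move=> ik; rewrite flen_take // wM leq_add2l.
pose Z i := cone (ftake (N + i) w).
have w0 : (0 < flen w)%N by rewrite wM addSn.
have ZV i : (i <= k)%N -> crosses (Z i) V.
  move=> ik; have z0 : (0 < flen (ftake (N + i) w))%N by rewrite Np // addSn.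
  have wZ : cone w `<=` Z i by apply: cone_le => //; exact: prefix_ftake.
  have [u1 wu1 Vu1] : exists2 u, cone w u & ~ V u.
    apply: contrapT => h; apply: nc; left => u wu; apply: contrapT => Vu.
    by apply: h; exists u.
  have [u2 wu2 Vu2] : exists2 u, cone w u & V u.
    apply: contrapT => h; apply: nc; right => u wu Vu.
    by apply: h; exists u.
  have [VW1 VW2 VW3 VW4] := VW.
  have Zu1 : Z i u1 by apply: wZ.
  have Zu2 : Z i u2 by apply: wZ.
  have [h|h] := HN (N + i)%N _ (leq_trans (leqnSn N0) (leq_addr i N)) (Np i ik).
    split; [by exists u2|by exists u1| |].
      by have [u [Vu nWu]] := VW2; exists u; split=> // /h.
    by have [u [Vu nWu]] := VW4; exists u; split=> // /h.
  split; [by exists u2|by exists u1| |].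
    by have [u [Vu Wu]] := VW1; exists u; split=> // /h; apply.
  by have [u [Vu Wu]] := VW3; exists u; split=> // /h; apply.
(* The prefixes of lengths N to N + k give k + 1 distinct cuts crossing V, one more than [s] can
   hold. *)
suff : (size (map Z (iota 0 k.+1)) <= size s)%N.
  by rewrite size_map size_iota leqNgt ltnS sk.
apply: uniq_leq_size.
  rewrite map_inj_in_uniq ?iota_uniq // => i j; rewrite !mem_iota !add0n !ltnS /=.
  move=> ik jk Zij; apply/eqP; rewrite eqn_leq; apply: contraT; rewrite negb_and -!ltnNge.
  have L i' j' : (i' < j')%N -> (j' <= k)%N -> Z i' <> Z j'.
    move=> ij jk'; apply: cone_neq; rewrite ?Np ?addSn //; try lia.
    rewrite -(@ftake_take _ (N + i') (N + j')) ?leq_add2l; [|by lia].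
    exact: prefix_ftake.
  by case/orP => /L; [move=> /(_ ik)|move=> /(_ jk)]; rewrite Zij => /(_ _) [].
move=> F /mapP[i]; rewrite mem_iota add0n ltnS => /andP[_ ik] ->.
apply: Hs; last exact: ZV.
have [C [x [cC e]]] : radius_shadow cone_radius (Z i).
  by apply: cone_radius_shadow; rewrite Np // addSn.
exists C, x; split=> //; apply: (cut_at_le Erefl Esym (r := 0)) cC => //.
by rewrite addn0.
Qed.

End Lattice.

(** * Optimally nested cuts *)

Lemma argmin_nat (T : Type) (S : set T) (f : T -> nat) : S !=set0 ->
  exists2 x, S x & forall y, S y -> (f x <= f y)%N.
Proof.
move=> [x0 Sx0].
have : exists n, `[< exists2 x, S x & f x = n >] by exists (f x0); apply/asboolP; exists x0.
case/ex_minnP=> n /asboolP[x Sx <-] min; exists x => // y Sy.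
by apply: min; apply/asboolP; exists y.
Qed.

Section Nested.
Variable P : Type.
Implicit Types A B C D V W : set P.

Lemma crosses_sym A B : crosses A B -> crosses B A.
Proof. by rewrite /crosses ![A `&` _]setIC ![~` A `&` _]setIC => -[]. Qed.

Lemma crossesC A B : crosses A B -> crosses A (~` B).
Proof. by rewrite /crosses setCK => -[]. Qed.

Lemma crosses_corner A C D : crosses C D -> crosses A (C `&` D) ->
  crosses A C \/ crosses A D.
Proof.
move=> [_ _ _ [x [nCx nDx]]] [[a [Aa [Ca Da]]] [b [Ab nb]] [c [nAc [Cc Dc]]] [d [nAd nd]]].
have cr U : U a -> U c -> A `&` ~` U !=set0 -> ~` A `&` ~` U !=set0 -> crosses A U.
  by move=> Ua Uc *; split=> //; [exists a|exists c].
have [hx|hx] := pselect (A x).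
  have [Cd|Cd] := pselect (C d); last by left; apply: cr => //; [exists x|exists d].
  by right; apply: cr => //; [exists x|exists d; split=> // Dd; apply: nd].
have [Cb|Cb] := pselect (C b); last by left; apply: cr => //; [exists b|exists x].
by right; apply: cr => //; [exists b; split=> // Db; apply: nb|exists x].
Qed.

Lemma crosses_corners A C D : crosses A (C `&` D) ->
  crosses A (~` C `&` ~` D) -> crosses A C /\ crosses A D.
Proof.
move=> [[a [Aa [Ca Da]]] _ [b [Ab [Cb Db]]] _].
move=> [[c [Ac [Cc Dc]]] _ [d [Ad [Cd Dd]]] _].
by split; split; [exists a|exists c|exists b|exists d|exists a|exists c|exists b|exists d].
Qed.

Definition crossed_by (F : set (set P)) W : set (set P) :=
  [set V | F V /\ crosses V W].

(** [fset_set] is empty on infinite sets, so the number is meaningful only together with a proof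
    that [crossed_by F W] is finite. *)
Definition cross_count F W : nat := #|` fset_set (crossed_by F W)|.

Lemma cross_countC F W : cross_count F (~` W) = cross_count F W.
Proof.
congr #|` fset_set _|; apply/seteqP; split=> V [FV] /crossesC; rewrite ?setCK //.
Qed.

(** A set crossing one of the two corners crosses C or D, and a set crossing both corners crosses C
    and D. The extra term is C itself: it crosses D but neither corner, so the inequality is strict
    once C belongs to [F]. *)
Lemma cross_count_corners (F : set (set P)) C D : crosses C D ->
  finite_set (crossed_by F C) -> finite_set (crossed_by F D) ->
  ((cross_count F (C `&` D) + cross_count F (~` C `&` ~` D) + `[< F C >]
   <= cross_count F C + cross_count F D)%N).
Proof.
move=> CD fC fD.
have sub1 V : crosses V (C `&` D) -> crosses V C \/ crosses V D by apply: crosses_corner.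
have sub2 V : crosses V (~` C `&` ~` D) -> crosses V C \/ crosses V D.
  have CD' : crosses (~` C) (~` D) by apply/crossesC/crosses_sym/crossesC/crosses_sym.
  case/(crosses_corner CD') => /crossesC; rewrite setCK; by [left|right].
have fU : finite_set (crossed_by F C `|` crossed_by F D) by rewrite finite_setU.
have f1 : finite_set (crossed_by F (C `&` D)).
  by apply: sub_finite_set fU => V [FV /sub1 []]; [left|right].
have f2 : finite_set (crossed_by F (~` C `&` ~` D)).
  by apply: sub_finite_set fU => V [FV /sub2 []]; [left|right].
rewrite /cross_count -cardfsUI -[leqRHS]cardfsUI addnAC.
have I : (fset_set (crossed_by F (C `&` D)) `&`
          fset_set (crossed_by F (~` C `&` ~` D)) `<=`
          fset_set (crossed_by F C) `&` fset_set (crossed_by F D))%fset.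
  apply/fsubsetP => V; rewrite !inE !in_fset_set //.
  move=> /andP[/set_mem[FV V1] /set_mem[_ V2]].
  by have [? ?] := crosses_corners V1 V2; apply/andP; split; apply/mem_set.
apply: leq_add; last exact: fsubset_leq_card.
have U : (fset_set (crossed_by F (C `&` D)) `|`
          fset_set (crossed_by F (~` C `&` ~` D)) `<=`
          fset_set (crossed_by F C) `|` fset_set (crossed_by F D))%fset.
  apply/fsubsetP => V; rewrite !inE !in_fset_set //.
  move=> /orP[] /set_mem[FV]; [move/sub1|move/sub2] => -[] h; apply/orP;
    by [left; apply/mem_set|right; apply/mem_set].
case: asboolP => FC; last by rewrite addn0; exact: fsubset_leq_card.
rewrite addn1; apply: fproper_ltn_card; rewrite fproperE U /=.
apply/negP => /fsubsetP /(_ C); rewrite !inE !in_fset_set //.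
have -> : C \in crossed_by F D by apply/mem_set.
rewrite orbT => /(_ isT) /orP[] /set_mem[_ [h1 _ h3 _]].
  by have [x [nCx []]] := h3.
by have [x [Cx []]] := h1.
Qed.

Section OptimallyNested.
Variables (B F : set (set P)).
Hypothesis BC : forall W, B W -> B (~` W).
Hypothesis BI : forall V W, B V -> B W -> B (V `&` W).
Hypothesis Bex : exists W, [/\ B W, W !=set0 & ~` W !=set0].
Hypothesis Ffin : forall W, B W -> finite_set (crossed_by F W).
Hypothesis Bfin : forall W k, B W ->
  finite_set [set V | B V /\ crosses V W /\ (cross_count F V <= k)%N].

Lemma nested_family : exists E : set (set P),
  [/\ E !=set0,
      forall W, E W -> [/\ B W, W !=set0 & ~` W !=set0],
      forall W, E W -> E (~` W),
      forall V W, E V -> E W -> ~ crosses V W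
    & forall f g : P -> P, cancel f g -> cancel g f ->
       (forall W, B W -> B (f @^-1` W)) -> (forall W, B W -> B (g @^-1` W)) ->
       (forall W, F W -> F (f @^-1` W)) -> (forall W, F W -> F (g @^-1` W)) ->
       forall W, E W -> E (f @^-1` W)].
Proof.
pose N := [set W | [/\ B W, W !=set0 & ~` W !=set0]].
have [W0 NW0 minW0] := argmin_nat (cross_count F) (Bex : N !=set0).
set k := cross_count F W0 in minW0.
pose M := [set W | N W /\ cross_count F W = k].
(* Minimizers have no prescribed radius; their common first count k is what leaves only finitely
   many of them crossing W. *)
have Mfin W : M W -> finite_set (crossed_by M W).
  move=> [[BW _ _] _]; apply: sub_finite_set (Bfin k BW).
  by move=> V [[[BV _ _] eV] VW]; rewrite /mkset eV.
have MC W : M W -> M (~` W).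
  move=> [[BW W0' W1] eW]; split; last by rewrite cross_countC.
  by split; [apply: BC|exact: W1|rewrite setCK].
have [W1 MW1 minW1] := argmin_nat (cross_count M) (ex_intro _ W0 (conj NW0 erefl) : M !=set0).
set m := cross_count M W1 in minW1.
exists [set W | M W /\ cross_count M W = m]; split.
- by exists W1.
- by move=> W [[]].
- by move=> W [MW eW]; split; [exact: MC|rewrite cross_countC].
- move=> C D [MC' eC] [MD eD] CD.
  have [BC' _ _] := MC'.1; have [BD _ _] := MD.1; have [CD1 CD2 CD3 CD4] := CD.
  have N1 : N (C `&` D).
    split; [exact: BI|by []|]; have [x [Cx nDx]] := CD2.
    by exists x => -[].
  have N2 : N (~` C `&` ~` D).
    split; [by apply: BI; apply: BC|by []|]; have [x [Cx nDx]] := CD1.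
    by exists x => -[].
  have := cross_count_corners CD (Ffin BC') (Ffin BD).
  rewrite MC'.2 MD.2 => le2k.
  have M1 : M (C `&` D) by split=> //; have := minW0 _ N1; have := minW0 _ N2; lia.
  have M2 : M (~` C `&` ~` D) by split=> //; have := minW0 _ N1; have := minW0 _ N2; lia.
  (* The second count yields strictness: C lies in [M], and both corners are minimizers with count
     at least m, so 2 m + 1 would be at most 2 m. *)
  have := cross_count_corners CD (Mfin _ MC') (Mfin _ MD).
  rewrite eC eD asboolT //; have := minW1 _ M1; have := minW1 _ M2; lia.
move=> f g fK gK Bf Bg Ff Fg.
have crf (h h' : P -> P) V W : cancel h' h -> crosses V W -> crosses (h @^-1` V) (h @^-1` W).
  move=> hK [[a aP] [b bP] [c cP] [d dP]].
  by split; [exists (h' a)|exists (h' b)|exists (h' c)|exists (h' d)];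
    rewrite /preimage /setI /setC /mkset /= hK.
have count_pre (H : set (set P)) W :
    (forall W, H W -> H (f @^-1` W)) -> (forall W, H W -> H (g @^-1` W)) ->
    finite_set (crossed_by H W) ->
    cross_count H (f @^-1` W) = cross_count H W.
  move=> Hf Hg fin.
  have fgK V : f @^-1` (g @^-1` V) = V.
    by apply/seteqP; split=> x; rewrite /preimage /mkset /= fK.
  have gfK V : g @^-1` (f @^-1` V) = V.
    by apply/seteqP; split=> x; rewrite /preimage /mkset /= gK.
  rewrite /cross_count (_ : crossed_by H (f @^-1` W) = preimage f @` crossed_by H W).
    rewrite fset_set_image // card_imfset //=.
    by move=> V V' e; rewrite -(gfK V) e gfK.
  apply/seteqP; split=> V.
    move=> [HV cV]; exists (g @^-1` V); last exact: fgK.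
    by split; [exact: Hg|rewrite -(gfK W); have := crf g f V (f @^-1` W) fK; apply].
  by move=> [V' [HV cV] <-]; split; [exact: Hf|have := crf f g V' W gK; apply].
have NP (h h' : P -> P) W : cancel h h' -> cancel h' h ->  (forall W, B W -> B (h @^-1` W)) ->
    N W -> N (h @^-1` W).
  move=> hK h'K Bh [BW [x Wx] [y nWy]].
  by split; [exact: Bh|exists (h' x)|exists (h' y)]; rewrite /preimage /setC /mkset /= h'K.
have MP W : M W -> M (f @^-1` W).
  move=> [NW eW]; split; first exact: (NP f g).
  by rewrite count_pre //; apply: Ffin; case: NW.
have MP' W : M W -> M (g @^-1` W).
  move=> [NW eW]; split; first exact: (NP g f).
  have NgW : N (g @^-1` W) by apply: (NP g f).
  rewrite -count_pre //; last by apply: Ffin; case: NgW.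
  rewrite (_ : f @^-1` _ = W) //.
  by apply/seteqP; split=> x; rewrite /preimage /mkset /= fK.
by move=> W [MW eW]; split; [exact: MP|rewrite count_pre //; apply: Mfin].
Qed.

End OptimallyNested.
End Nested.

(** * Actions of a free product on a nested family *)

Section Degree.
Variable P : Type.
Implicit Types (EE : set (set P)) (V W : set P).

(** For W seen as an oriented edge of a tree, these are the edges that follow it; their number is
    the valence of its endpoint minus 1. *)
Definition max_below EE W : set (set P) :=
  [set V | [/\ EE V, V `<=` W, V <> W
    & forall V', EE V' -> V `<=` V' -> V' `<=` W -> V' <> W -> V' = V]].

Definition degree_is EE W (n : nat) : Prop :=
  exists s : seq (set P),
    [/\ uniq s, size s = n & forall V, V \in s <-> max_below EE W V].

Lemma degree_unique EE W m n : degree_is EE W m -> degree_is EE W n -> m = n.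
Proof.
move=> [s [us <- sP]] [t [ut <- tP]]; apply/eqP; rewrite eqn_leq.
by apply/andP; split; apply: uniq_leq_size => // V; [move/sP/tP|move/tP/sP].
Qed.

Lemma degree_preimage EE W n (f g : P -> P) : cancel f g -> cancel g f ->
  (forall V, EE V -> EE (f @^-1` V)) -> (forall V, EE V -> EE (g @^-1` V)) ->
  degree_is EE W n -> degree_is EE (f @^-1` W) n.
Proof.
move=> fK gK Ef Eg [s [us sn sP]].
have fgK V : f @^-1` (g @^-1` V) = V.
  by apply/seteqP; split=> x; rewrite /preimage /mkset /= fK.
have gfK V : g @^-1` (f @^-1` V) = V.
  by apply/seteqP; split=> x; rewrite /preimage /mkset /= gK.
have finj : injective (preimage f : set P -> set P) by apply: can_inj gfK.
exists (map (preimage f) s); split.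
- by rewrite map_inj_uniq.
- by rewrite size_map.
move=> V; rewrite -(fgK V) mem_map //; split=> [/sP|] [EV VW nVW maxV].
  split; [exact: Ef|by move=> x /VW|by move/finj|].
  move=> V' EV' VV' V'W nV'W; rewrite -(fgK V'); congr (_ @^-1` _).
  apply: maxV; [exact: Eg| | |].
  - by move=> x Vx; apply: VV'; rewrite /preimage /mkset /= gK.
  - by move=> x /V'W; rewrite /preimage /mkset /= gK.
  - by move=> e; apply: nV'W; rewrite -(fgK V') e.
apply/sP; split.
- by rewrite -(gfK (g @^-1` V)); apply: Eg.
- by move=> x Vx; rewrite -[x]gK; apply: VW; rewrite /preimage /mkset /= gK.
- by move=> e; apply: nVW; rewrite e.
move=> V' EV' VV' V'W nV'W; apply: (finj); apply: maxV.
- exact: Ef.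
- by move=> x /VV'.
- by move=> x /V'W.
- by move/finj.
Qed.

End Degree.

(** * The two factors as vertex stabilizers, and ping-pong *)

Section TreeAction.
Local Open Scope ring_scope.
Variable p : nat.
Hypothesis two_neq0 : (2%:R : 'F_p) != 0.
Local Notation G := (free_product p).

Lemma fp_ind (Q : G -> Prop) : Q 1%g -> (forall g a, Q g -> Q (g * syl a)%g) ->
  forall g, Q g.
Proof.
move=> Q1 QS g; rewrite -[g](@ftake_ge _ (flen g)) //.
have a0 : syllable p := (true, 0).
have H i : (i <= flen g)%N -> Q (ftake i g).
  elim: i => [_|i IH ig]; last by rewrite (ftakeS a0) //; apply/QS/IH/ltnW.
  by rewrite (_ : ftake 0 g = 1%g) //; apply: val_inj; rewrite /= take0.
exact: H.
Qed.

Variables (P : Type) (pact : G -> P -> P) (B : set (set P)).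
Hypothesis pact1 : forall u, pact 1%g u = u.
Hypothesis pactM : forall g h u, pact (g * h)%g u = pact g (pact h u).
Hypothesis BC : forall W, B W -> B (~` W).
Hypothesis BI : forall V W, B V -> B W -> B (V `&` W).
Hypothesis Btr : forall g W, B W -> B (pact g @^-1` W).
Hypothesis Bexp : forall W, B W -> W !=set0 ->
  exists g, ~` W `<=` pact g @^-1` W.
Implicit Types (g h : G) (U V W : set P) (s : bool) (x y z : 'F_p).

Local Notation rot s x := (pact (syl (s, x))).

Lemma rotD s x y u : rot s x (rot s y u) = rot s (x + y) u.
Proof. by rewrite -pactM sylM. Qed.

Lemma rot0 s u : rot s 0 u = u.
Proof. by rewrite syl_eq1 pact1. Qed.

Definition rot_fixed s W := forall x u, W (rot s x u) <-> W u.

(* W lies on the far side of the vertex fixed by the factor s. *)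
Definition rot_small s W := forall x u, x != 0 -> W (rot s x u) -> ~ W u.

(** The translates of a point of U by 1 and -1 leave U, so both lie in V; but they differ by the
    rotation 2, which is not trivial. *)
Lemma not_small_cover s U V : rot_small s U -> rot_small s V ->
  ~` U `<=` V -> ~ (U !=set0).
Proof.
move=> sU sV UV [u Uu].
have H x : x != 0 -> V (rot s x u).
  by move=> x0; apply: UV => Ux; apply: (sU _ _ x0 Ux Uu).
have one0 : (1 : 'F_p) != 0 by rewrite oner_eq0.
apply: (sV 2%:R (rot s (- 1) u)) => //.
  rewrite rotD (_ : 2%:R + -1 = 1); first exact: H.
  by rewrite mulr2n addrK.
by apply: H; rewrite oppr_eq0.
Qed.

Lemma not_small_fixed_cover s U V : rot_small s U -> rot_fixed s V ->
  ~` U `<=` V -> V = setT.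
Proof.
move=> sU fV UV; apply/seteqP; split=> // u _.
have [Uu|] := pselect (U u); last exact: UV.
apply/(fV 1); apply: UV => Uu1.
by apply: sU Uu1 Uu; rewrite oner_eq0.
Qed.

Section NestedFamily.
Variable EE : set (set P).
Hypothesis EB : forall W, EE W -> [/\ B W, W !=set0 & ~` W !=set0].
Hypothesis EC : forall W, EE W -> EE (~` W).
Hypothesis Enest : forall V W, EE V -> EE W -> ~ crosses V W.
Hypothesis Etr : forall g W, EE W -> EE (pact g @^-1` W).

Lemma nestedP V W : EE V -> EE W ->
  [\/ V `<=` W, W `<=` V, V `<=` ~` W | ~` V `<=` W].
Proof.
move=> EV EW; have nVW := Enest EV EW; apply: contrapT => h.
have ex U U' : ~ U `<=` U' -> U `&` ~` U' !=set0.
  move=> nUU'; apply: contrapT => ne; apply: nUU' => u Uu.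
  by apply: contrapT => nu; apply: ne; exists u.
apply: nVW; split.
- by rewrite -[W]setCK; apply: ex => ?; apply: h; constructor 3.
- by apply: ex => ?; apply: h; constructor 1.
- by rewrite setIC; apply: ex => ?; apply: h; constructor 2.
- by apply: ex => ?; apply: h; constructor 4.
Qed.

Lemma rot_mulrn s W x n :
  (forall u, W (rot s x u) -> W u) -> forall u, W (rot s (x *+ n) u) -> W u.
Proof.
move=> Wx; elim: n => [|n IH] u; first by rewrite mulr0n rot0.
by rewrite mulrS -rotD => /Wx /IH.
Qed.

Lemma Fp_mulrn x y : x != 0 -> exists n, y = x *+ n.
Proof.
move=> x0; exists (val (y / x)); rewrite -mulr_natr natr_Zp.
by rewrite mulrC divfK.
Qed.

Lemma rot_sub_fixed s W x : x != 0 ->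
  (forall u, W (rot s x u) -> W u) -> rot_fixed s W.
Proof.
move=> x0 Wx y u; have H z v : W (rot s z v) -> W v.
  by have [n ->] := Fp_mulrn z x0; apply: rot_mulrn.
by split; [exact: H|rewrite -{1}[u](rot0 s) -(addNr y) -rotD; exact: H].
Qed.

(** By nestedness each nonzero x maps W into itself or its inverse does, or it moves W or its
    complement off itself. The first alternative gives invariance, as x generates the factor. If x
    is of the second kind and y of the third, their difference maps W into itself; if x = y, then 2
    x does. *)
Lemma rot_types s W : EE W ->
  [\/ rot_fixed s W, rot_small s W | rot_small s (~` W)].
Proof.
move=> EW; have [BW [w Ww] [w' nWw']] := EB EW.
apply: contrapT => h.
have nf : ~ rot_fixed s W by move=> ?; apply: h; constructor 1.
have alt x : x != 0 -> (forall u, W (rot s x u) -> ~ W u) \/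
                       (forall u, ~ W (rot s x u) -> W u).
  move=> x0; have [VW|WV|VW|VW] := nestedP (Etr (syl (s, x)) EW) EW.
  - by case: nf; apply: rot_sub_fixed x0 _.
  - case: nf; apply: (@rot_sub_fixed s W (- x)); first by rewrite oppr_eq0.
    by move=> u /WV; rewrite /preimage /mkset rotD subrr rot0.
  - by left.
  - by right.
have [x [x0 Wx]] : exists x, x != 0 /\ (forall u, W (rot s x u) -> ~ W u).
  apply: contrapT => nx; apply: h; constructor 3 => x u x0 nW; apply.
  have [Wx|] := alt _ x0; last exact.
  by case: nx; exists x.
have [y [y0 Wy]] : exists y, y != 0 /\ (forall u, ~ W (rot s y u) -> W u).
  apply: contrapT => ny; apply: h; constructor 2 => y u y0.
  have [Wy|Wy] := alt _ y0; first exact: Wy.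
  by case: ny; exists y.
have H u : W u -> W (rot s (y - x) u).
  move=> Wu; apply: contrapT => n.
  have := Wy (rot s (- x) u); rewrite rotD => /(_ n) => n'.
  by apply: (Wx _ _ n'); rewrite rotD subrr rot0.
have [yx|yx] := eqVneq y x.
  subst y; apply: nf; apply: (@rot_sub_fixed s W (x + x)).
    by rewrite -mulr2n -mulr_natl mulf_neq0.
  by move=> u; rewrite -rotD => /Wx /Wy.
apply: nf; apply: (@rot_sub_fixed s W (x - y)); first by rewrite subr_eq0 eq_sym.
by move=> u /H; rewrite rotD addrC subrKA subrr rot0.
Qed.

Lemma not_globally_fixed W : EE W -> ~ (rot_fixed true W /\ rot_fixed false W).
Proof.
move=> EW [f1 f2]; have [BW W0 [w nWw]] := EB EW.
have fW g : forall u, W (pact g u) <-> W u.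
  elim/fp_ind: g => [u|g [s x] IH u]; first by rewrite pact1.
  by rewrite pactM IH; case: s; [apply: f1|apply: f2].
have [g gW] := Bexp BW W0.
by have := gW _ nWw; rewrite /preimage /mkset fW.
Qed.

(** If no member separated the fixed vertices of the two factors, being small for some factor would
    be a property invariant under the group. But [Bexp] gives a small W with a translate V
    containing its complement, and every combination of factors for W and V is contradictory. *)
Lemma exists_separating : EE !=set0 ->
  exists D, [/\ EE D, rot_small true D & rot_small false (~` D)].
Proof.
move=> [W0 EW0]; apply: contrapT => nsep.
have nsep1 W : EE W -> rot_small true W -> rot_small false (~` W) -> False.
  by move=> *; apply: nsep; exists W.
have nsep2 s W : EE W -> rot_small s W -> rot_small (~~ s) (~` W) -> False.
  case: s => EW sW sW'; first exact: (nsep1 W EW sW sW').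
  by apply: (nsep1 (~` W) (EC EW) sW'); rewrite setCK.
pose away W := exists s, rot_small s W.
have awayP W : EE W -> away W \/ away (~` W).
  move=> EW; have := not_globally_fixed EW.
  have [f1|?|?] := rot_types true EW; [|by left; exists true|by right; exists true].
  have [f2|?|?] := rot_types false EW; [|by left; exists false|by right; exists false].
  by case.
have away_rot s x W : EE W -> away W -> away (rot s x @^-1` W).
  move=> EW [t tW]; have [st|st] := eqVneq s t.
    subst t; exists s => y u y0; rewrite /preimage /mkset rotD addrC -rotD.
    exact: tW.
  have [fW|sW|sW] := rot_types s EW.
  - exists t; rewrite (_ : _ @^-1` W = W) //.
    by apply/seteqP; split=> u; rewrite /preimage /mkset (fW x u).
  - exists s => y u y0; rewrite /preimage /mkset rotD addrC -rotD.
    exact: sW.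
  - have ts : s = ~~ t by case: (s) (t) st => [] [].
    by case: (nsep2 t W EW tW); rewrite -ts.
have [W [EW aW]] : exists W, EE W /\ away W.
  by have [?|?] := awayP _ EW0; [exists W0|exists (~` W0); split=> //; apply: EC].
have [BW Wn _] := EB EW; have [g gW] := Bexp BW Wn.
have : EE (pact g @^-1` W) /\ away (pact g @^-1` W).
  elim/fp_ind: g {gW} => [|g [s x] [Eg ag]].
    rewrite (_ : _ @^-1` W = W) //.
    by apply/seteqP; split=> u; rewrite /preimage /mkset pact1.
  rewrite (_ : _ @^-1` W = rot s x @^-1` (pact g @^-1` W)).
    by split; [exact: Etr|exact: away_rot].
  by apply/seteqP; split=> u; rewrite /preimage /mkset pactM.
move: (pact g @^-1` W) gW => V WV [EV [t tV]].
have [BV _ [v nVv]] := EB EV.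
have [s sW] := aW; have [st|st] := eqVneq s t.
  by subst t; apply: (not_small_cover sW tV WV Wn).
have ts : t = ~~ s by case: (s) (t) st => [] [].
have [fV|sV|sV] := rot_types s EV.
- by have VT := not_small_fixed_cover sW fV WV; apply: nVv; rewrite VT.
- exact: (not_small_cover sW sV WV Wn).
- by apply: (nsep2 t V) => //; rewrite ts negbK.
Qed.

Lemma pact_foldr g u : pact g u = foldr (fun a => pact (syl a)) u (syl_of g).
Proof.
case: g => w rw /=; elim: w rw => [|a w IH] raw.
  by rewrite (_ : FreeProduct raw = 1%g) ?pact1 //; apply: val_inj.
have rw := alternating_behead raw.
rewrite /= -(IH rw) -pactM; congr pact; apply: val_inj => /=.
have a0 : a.2 != 0 by move: raw; rewrite alternating_cons => /and3P[].
by rewrite {1}/spush (negbTE a0) /= spush_cons.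
Qed.

(** Nontrivial elements of the factor s carry D into its complement, those of the other factor carry
    the complement into D. The condition on u starts the induction, where a syllable of s must not
    reach D. *)
Lemma pingpong s D w u : alternating w ->
  rot_small s D -> rot_small (~~ s) (~` D) ->
  (forall x, ~ D (rot s x u)) ->
  if w is a :: _ then
    D (foldr (fun a => pact (syl a)) u w) <-> a.1 != s
  else True.
Proof.
move=> + sD sD' Du.
elim: w => // -[t x] w IH; rewrite alternating_cons => /and3P[/= x0 hw rw].
have {}IH := IH rw; case: w hw rw IH => [_ _ _|[t' x'] w] /=.
  have [->|ts] := eqVneq t s; first by split=> // /Du.
  have -> : t = ~~ s by case: (s) (t) ts => [] [].
  split=> // _; apply: contrapT => nD; apply: (sD' _ _ x0 nD).
  by rewrite -[u](rot0 s); apply: Du.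
set v := rot t' x' _ => tt' _ IH; have [ts|ts] := eqVneq t s.
  split=> [Dv|]; last by [].
  exfalso; apply: (sD x v x0); first by rewrite -ts.
  by apply/IH; rewrite -ts eq_sym.
split=> // _; apply: contrapT => nD.
have tS : t = ~~ s by case: (s) (t) ts => [] [].
apply: (sD' x v x0); first by rewrite -tS.
by move/IH; case: (s) (t) (t') tS tt' => [] [] [].
Qed.

Lemma syl_neq s x y : y != 0 -> syl (s, x) <> syl (~~ s, y) :> G.
Proof.
move=> y0 /(congr1 (@syl_of p)); rewrite /= /spush /= (negbTE y0).
by case: eqP => // _ []; case: s.
Qed.

(* Otherwise the uncovered set V is moved off itself by every element outside
   the factor s, while some element g maps the complement of V into V. *)
Lemma rot_cover s D : B D -> D !=set0 ->
  rot_small s D -> rot_small (~~ s) (~` D) -> forall u, exists x, D (rot s x u).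
Proof.
move=> BD [d Dd] sD sD' u0; apply: contrapT => nu0.
pose V := [set u | forall x, ~ D (rot s x u)].
have BV : B V.
  have BT : B setT.
    by rewrite -[setT]setCK setCT -(setICr D); apply/BC/BI => //; apply: BC.
  suff H (l : seq 'F_p) : B [set u | forall x, x \in l -> ~ D (rot s x u)].
    rewrite (_ : V = [set u | forall x, x \in enum 'F_p -> ~ D (rot s x u)]) //.
    by apply/seteqP; split=> u h x => [_|]; apply: h; rewrite ?mem_enum.
  elim: l => [|y l IH]; first by rewrite (_ : [set _ | _] = setT) // -subTset.
  rewrite (_ : [set _ | _] = (~` (rot s y @^-1` D)) `&`
     [set u | forall x, x \in l -> ~ D (rot s x u)]).
    by apply: BI => //; apply/BC/Btr.
  apply/seteqP; split=> u.
    by move=> h; split=> [|x xl]; apply: h; rewrite inE ?eqxx ?xl ?orbT.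
  by move=> [hy hl] x; rewrite inE => /orP[/eqP ->|/hl].
have V0 : V u0 by move=> x Dx; apply: nu0; exists x.
have [g gV] := Bexp BV (ex_intro _ u0 V0).
have stabV h : V (pact h u0) -> exists x, h = syl (s, x).
  rewrite pact_foldr; have := pingpong (syl_ofP h) sD sD' V0.
  case E : (syl_of h) (syl_ofP h) => [|[t x] w] /= rh.
    move=> _ _; exists 0; rewrite syl_eq1; apply: val_inj; exact: E.
  set v := foldr _ _ w => pw Vv.
  have [ts|ts] := eqVneq t s; last first.
    by case: (Vv 0); rewrite rot0; apply/pw.
  have := pingpong (alternating_behead rh) sD sD' V0.
  case: w @v E rh pw Vv => [|[t' x'] w] v E rh _ Vv pw.
    exists x; apply: val_inj; rewrite /= E ts /spush /=.
    by move: rh; rewrite alternating_cons /= => /andP[/negbTE ->].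
  case: (Vv (- x)); rewrite -ts rotD addNr rot0; apply/pw => /=.
  by move: rh; rewrite alternating_cons -ts [t' == t]eq_sym => /and3P[].
(* A nontrivial element of the other factor moves [u0] into D, hence out of V, and g brings it back
   into V, so [stabV] applies to the product. Comparing y = 1 with y = -1 then identifies -2 in one
   factor with an element of the other. *)
have H y : y != 0 -> exists x, (g * syl (~~ s, y) = syl (s, x))%g.
  move=> y0; apply: stabV; rewrite pactM; apply: gV => /(_ 0); rewrite rot0; apply.
  apply: contrapT => nD; apply: (sD' _ _ y0 nD).
  by rewrite -[u0](rot0 s); apply: V0.
have one0 : (1 : 'F_p) != 0 by rewrite oner_eq0.
have mone0 : (- 1 : 'F_p) != 0 by rewrite oppr_eq0.
have [x ex] := H _ one0; have [y ey] := H _ mone0.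
apply: (@syl_neq s (y - x) (- 2%:R)); first by rewrite oppr_eq0.
apply: (@mulgI _ (syl (s, x))); rewrite sylM addrC subrK -ex -mulgA sylM.
by rewrite -ey; congr (_ * syl (_, _))%g; rewrite mulr2n opprD addrA subrr add0r.
Qed.

(** The translates [T x] of D form a partition, and the nonzero ones are the maximal members sought.
    A member strictly below the complement of D and inside no [T x] would be a union of translates;
    according to its type it would contain D, be a single translate, or fill the whole
    complement. *)
Lemma degree_small s D : EE D -> rot_small s D -> (forall u, exists x, D (rot s x u)) ->
  prime p -> degree_is EE (~` D) p.-1.
Proof.
move=> ED sD cD pp.
have [BD [d Dd] _] := EB ED.
pose T x := rot s (- x) @^-1` D.
have TE x u : T x u <-> D (rot s (- x) u) by [].
have ET x : EE (T x) by apply: Etr.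
have Tcov u : exists x, T x u.
  by have [x Dx] := cD u; exists (- x); rewrite TE opprK.
have Tdis x y u : T x u -> T y u -> x = y.
  move=> Tx Ty; apply/eqP; apply: contraT => xy.
  case: (sD (y - x) (rot s (- y) u)); rewrite ?subr_eq0 1?eq_sym //.
  by rewrite rotD addrAC subrr add0r.
have Tpt x : exists u, T x u by exists (rot s x d); rewrite TE rotD addNr rot0.
have T0 u : T 0 u <-> D u by rewrite TE oppr0 rot0.
have Trot x y u : T x (rot s y u) <-> T (x - y) u.
  by rewrite !TE rotD opprB addrC [y - x]addrC.
have TD x : x != 0 -> T x `<=` ~` D.
  by move=> x0 u Tx /T0 /(Tdis _ _ _ Tx) x0'; rewrite x0' eqxx in x0.
have one0 : (1 : 'F_p) != 0 by rewrite oner_eq0.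
have mone : (1 : 'F_p) != -1.
  by rewrite -subr_eq0 opprK -mulr2n.
have TnD x : T x <> ~` D.
  move=> e; have [y [y0 yx]] : exists y, y != 0 /\ y != x.
    have [->|x1] := eqVneq x 1.
      by exists (- 1); rewrite oppr_eq0; split; rewrite // eq_sym.
    by exists 1; split=> //; rewrite eq_sym.
  have [u Tu] := Tpt y; have := TD _ y0 _ Tu; rewrite -e => /Tdis /(_ Tu) xy.
  by rewrite xy eqxx in yx.
have below E : EE E -> E `<=` ~` D -> E <> ~` D -> exists x, x != 0 /\ E `<=` T x.
  move=> EE' ED' nE; apply: contrapT => nx; have [BE [e Ee] _] := EB EE'.
  have TE' x : T x `<=` E \/ T x `<=` ~` E.
    have [->|x0] := eqVneq x 0; first by right=> u /T0 Du /ED'.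
    have [h|h|h|h] := nestedP (ET x) EE'; [by left| |by right|].
      by case: nx; exists x.
    have : E d by apply: h => /(TD _ x0).
    by move/ED'.
  have inT x u : T x u -> E u -> T x `<=` E.
    by move=> Tu Eu; case: (TE' x) => // h; have := h _ Tu.
  have [fE|sE|sE] := rot_types s EE'.
  - have [x Tx] := Tcov e; have h := inT _ _ Tx Ee.
    have : E d by apply/(fE x); apply: h; rewrite TE rotD addNr rot0.
    by move/ED'.
  - have [x Tx] := Tcov e; apply: nx; exists x; split.
      by apply/eqP => x0; subst x; move/T0: Tx; apply: ED'.
    move=> u Eu; have [y Ty] := Tcov u.
    have [<- //|yx] := eqVneq y x.
    have hx := inT _ _ Tx Ee; have hy := inT _ _ Ty Eu.
    case: (sE (x - y) u) => //; first by rewrite subr_eq0 eq_sym.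
    by apply: hx; rewrite Trot opprB addrC subrK.
  - apply: nE; apply/seteqP; split=> // u Du; apply: contrapT => nEu.
    have [y Ty] := Tcov u.
    have y0 : y != 0 by apply/eqP => y0; subst y; move/T0: Ty.
    have hy : T y `<=` ~` E by case: (TE' y) => // h; have := h _ Ty.
    case: (sE (- y) u) => //; first by rewrite oppr_eq0.
    by move=> /ED'; apply; apply/T0; rewrite Trot sub0r opprK.
pose l := enum (predC1 (0 : 'F_p)).
have inl x : (x \in l) = (x != 0) by rewrite mem_enum.
exists (map T l); split.
- rewrite map_inj_uniq ?enum_uniq // => x y e.
  by have [u Tu] := Tpt x; apply: (Tdis _ _ u) => //; rewrite -e.
- by rewrite size_map -cardE cardC1 card_Fp.
move=> V; split.
  case/mapP=> x; rewrite inl => x0 ->.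
  split=> //; first exact: TD.
  move=> V' EV' TV' V'D nV'.
  have [y [y0 V'y]] := below _ EV' V'D nV'.
  have [u Tu] := Tpt x.
  have xy : x = y by apply: (Tdis _ _ u) => //; apply/V'y/TV'.
  by apply/seteqP; split => //; rewrite xy.
move=> [EV VD nV maxV].
have [x [x0 Vx]] := below _ EV VD nV.
apply/mapP; exists x; rewrite ?inl //.
by rewrite (maxV (T x)) //; exact: TD.
Qed.

End NestedFamily.

Hypothesis p_prime : prime p.

Lemma degree_separating EE D :
  (forall W, EE W -> [/\ B W, W !=set0 & ~` W !=set0]) ->
  (forall W, EE W -> EE (~` W)) ->
  (forall V W, EE V -> EE W -> ~ crosses V W) ->
  (forall g W, EE W -> EE (pact g @^-1` W)) ->
  EE D -> rot_small true D -> rot_small false (~` D) ->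
  degree_is EE D p.-1 /\ degree_is EE (~` D) p.-1.
Proof.
move=> EB EC En Et ED sD sD'; have [BD D0 D1] := EB _ ED; split; last first.
  by apply: (degree_small EB En Et ED sD) => //; apply: rot_cover.
rewrite -[X in degree_is _ X]setCK.
apply: (degree_small EB En Et (EC _ ED) sD') => //; apply: rot_cover => //.
  exact: BC.
by rewrite setCK.
Qed.

End TreeAction.

Lemma Fp_two_neq0 p : prime p -> (2 < p)%N -> (2%:R : 'F_p)%R != 0%R.
Proof.
by move=> pp p2; rewrite -(dvdn_pcharf (pchar_Fp pp)) gtnNdvd.
Qed.

(** * Two free products acting on one graph *)

Section CommonLattice.
Variables (X : Type) (E : X -> X -> Prop).
Local Notation boundary := (boundary E).
Local Notation clopen := (@clopen_shadow X E).

Definition aut_invariant (EE : set (set boundary)) :=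
  forall (a : graph_aut E) W, EE W -> EE (bmap a @^-1` W).

Definition nested_system (EE : set (set boundary)) :=
  [/\ forall W, EE W -> [/\ clopen W, W !=set0 & ~` W !=set0],
      forall W, EE W -> EE (~` W),
      forall V W, EE V -> EE W -> ~ crosses V W
    & aut_invariant EE].

Section OneLattice.
Variables (p : nat) (p_prime : prime p) (p_gt2 : (2 < p)%N).
Variables (act : free_product p -> X -> X) (x0 : X).
Variables (D : nat) (ell : nat -> nat) (kap : nat).
Hypothesis Hlat : lattice_action E act x0 D ell kap.

Let Erefl := lat_refl Hlat.
Let Esym := lat_sym Hlat.
Let Econ := lat_con Hlat.
Let two0 := Fp_two_neq0 p_prime p_gt2.

Lemma lattice_nested_system : exists EE, nested_system EE /\ EE !=set0.
Proof.
(* At this radius all cones are among the counted cuts, as [few_crossings] demands. *)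
pose R := cone_radius D ell kap.
have [|||||EE [E0 Enon EC En Einv]] :=
  @nested_family boundary clopen (@radius_shadow X E R).
- by move=> W; apply: clopen_shadowC.
- by move=> V W; apply: clopen_shadowI.
- exact: (nontrivial_clopen Hlat).
- by move=> W BW; apply: (finite_crossing Hlat R).
- move=> W k BW; apply: sub_finite_set (few_crossings Hlat two0 k (leqnn _) BW).
  move=> V [BV [VW Vk]]; split=> //; exists (fset_set (crossed_by (@radius_shadow X E R) V)).
  split=> // F RF FV; rewrite in_fset_set ?mem_set //.
  exact: (finite_crossing Hlat R).
exists EE; split=> //; split=> // a W; apply: Einv.
- exact: (bmapK a).
- exact: (bmapVK a).
- by move=> V; apply: clopen_shadow_aut.
- by move=> V; apply: clopen_shadow_aut.
- by move=> V; apply: radius_shadow_aut.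
- by move=> V; apply: radius_shadow_aut.
Qed.

(** [C] is characterized by its position relative to the two factors, independently of the family,
    so its count is valid in every nested system containing it. This permits shrinking the family
    afterwards. *)
Lemma lattice_degree EE : nested_system EE -> EE !=set0 ->
  exists2 C, EE C & forall EE', nested_system EE' -> EE' C ->
    degree_is EE' C p.-1 /\ degree_is EE' (~` C) p.-1.
Proof.
move=> [Enon EC En Einv] E0.
pose pact g := bmap (lact Hlat g).
have pact1 u : pact 1%g u = u by apply: bmap1.
have pactM g h u : pact (g * h)%g u = pact g (pact h u) by apply: bmapM.
have BC W : clopen W -> clopen (~` W) by apply: clopen_shadowC.
have BI V W : clopen V -> clopen W -> clopen (V `&` W) by apply: clopen_shadowI.
have Btr g W : clopen W -> clopen (pact g @^-1` W) by apply: clopen_shadow_aut.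
have Bexp W : clopen W -> W !=set0 -> exists g, ~` W `<=` pact g @^-1` W.
  exact: (expanding Hlat).
have [C [EC' sC sC']] := exists_separating two0 pact1 pactM Bexp Enon EC En
  (fun g => Einv (lact Hlat g)) E0.
exists C => // EE' [Enon' EC'' En' Einv'] E'C.
exact: (degree_separating two0 pact1 pactM BC BI Btr Bexp p_prime
  Enon' EC'' En' (fun g => Einv' (lact Hlat g)) E'C sC sC').
Qed.

End OneLattice.

(** The initial family may have several orbits with different counts. Keeping the orbit of [C] and
    of its complement makes the count uniform, so it does not matter which member the second group
    selects. *)
Lemma orbit_system EE C : nested_system EE -> EE C -> forall n,
  (forall EE', nested_system EE' -> EE' C ->
    degree_is EE' C n /\ degree_is EE' (~` C) n) ->
  exists EE', [/\ nested_system EE', EE' !=set0 &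
    forall W, EE' W -> degree_is EE' W n].
Proof.
move=> [Enon EC En Einv] EEC n dC.
pose EE' := [set W | exists a : graph_aut E,
  W = bmap a @^-1` C \/ W = bmap a @^-1` (~` C)].
pose id_aut : graph_aut E :=
  @GraphAut X E id id (fun=> erefl) (fun=> erefl) (fun _ _ => id) (fun _ _ => id).
have idK (W : set boundary) : bmap id_aut @^-1` W = W.
  by apply/seteqP; split=> u; rewrite /preimage /mkset (_ : bmap _ u = u) //;
    apply: boundary_eq.
have sub W : EE' W -> EE W.
  by move=> [a [->|->]]; apply: Einv => //; apply: EC.
have E'C : EE' C by exists id_aut; left; rewrite idK.
have inv' : aut_invariant EE'.
  move=> a W [b bW].
  pose ba : graph_aut E := @GraphAut X E (b \o a) (aut_inv a \o aut_inv b)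
    (can_comp (aut_funK b) (aut_funK a)) (can_comp (aut_invK a) (aut_invK b))
    (fun x y xy => aut_funE b (aut_funE a xy))
    (fun x y xy => aut_invE a (aut_invE b xy)).
  have e V : bmap a @^-1` (bmap b @^-1` V) = bmap ba @^-1` V.
    apply/seteqP; split=> u; rewrite /preimage /mkset;
    by rewrite (_ : bmap ba u = bmap b (bmap a u)) //; apply: boundary_eq.
  by exists ba; case: bW => ->; rewrite e; [left|right].
have sys : nested_system EE'.
  split=> //; [by move=> W /sub /Enon| |by move=> V W /sub EV /sub; apply: En].
  move=> W [a [->|->]]; exists a; [by right|left].
  by rewrite preimage_setC setCK.
exists EE'; split=> //; first by exists C.
have [d1 d2] := dC _ sys E'C.
move=> W [a [->|->]]; apply: (degree_preimage (bmapK a) (bmapVK a)) => //.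
- by move=> V; apply: inv'.
- by move=> V; apply: inv'.
- by move=> V; apply: inv'.
- by move=> V; apply: inv'.
Qed.

Theorem no_common_lattice p q act act' x0 x0' D D' ell ell' kap kap' :
  prime p -> prime q -> (2 < p)%N -> (2 < q)%N -> p <> q ->
  @lattice_action p X E act x0 D ell kap ->
  @lattice_action q X E act' x0' D' ell' kap' -> False.
Proof.
move=> pp pq p2 q2 npq Lp Lq.
have [EE [sE E0]] := lattice_nested_system pp p2 Lp.
have [C EC dC] := lattice_degree pp p2 Lp sE E0.
have [EE' [sE' E0' dE']] := orbit_system sE EC dC.
have [C' EC' dC'] := lattice_degree pq q2 Lq sE' E0'.
have [dq _] := dC' _ sE' EC'.
have := degree_unique (dE' _ EC') dq; lia.
Qed.

End CommonLattice.

(** * Proper metric spaces and locally compact groups *)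

Lemma finite_bounded (T : Type) (A : set T) (f : T -> nat) :
  finite_set A -> exists n, forall x, A x -> (f x <= n)%N.
Proof.
move=> fA; have /finite_seqP[s sE] : finite_set (f @` A) by apply: finite_image.
exists (\max_(i <- s) i) => x Ax.
have : [set` s] (f x) by rewrite -sE; exists x.
by move=> /= fs; apply: (@leq_bigmax_seq _ s xpredT id).
Qed.

Section LatticeBuilder.
Variables (p : nat) (X : Type) (E : X -> X -> Prop).
Local Notation G := (free_product p).
Variables (act : G -> X -> X) (x0 : X) (D : nat).

Lemma lattice_action_of :
  (forall x, E x x) -> (forall x y, E x y -> E y x) ->
  (forall x y, exists r, reach E r x y) ->
  (forall x, act 1%g x = x) ->
  (forall g h x, act (g * h)%g x = act g (act h x)) ->
  (forall g x y, E x y -> E (act g x) (act g y)) ->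
  (forall x, exists g, reach E D (act g x0) x) ->
  (forall r, finite_set [set g | reach E r x0 (act g x0)]) ->
  exists ell kap, lattice_action E act x0 D ell kap.
Proof.
move=> Er Es Ec a1 aM aE aD afin.
have [ell ellP] := choice (fun r => finite_bounded (@flen p) (afin r)).
have [f fP] := choice (fun a : syllable p => Ec x0 (act (syl a) x0)).
exists ell, (\max_a f a); split=> // a.
by apply: reach_le (fP a) => //; apply: leq_bigmax.
Qed.

End LatticeBuilder.

Lemma compact_finite_cover (T : topologicalType) (A : set T) (I : choiceType)
    (O : I -> set T) :
  compact A -> (forall i, open (O i)) -> (forall x, A x -> exists i, O i x) ->
  exists s : seq I, forall x, A x -> exists2 i, i \in s & O i x.
Proof.
move=> cA oO AO; have [[x _]|A0] := pselect (A !=set0); last first.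
  by exists [::] => x Ax; case: A0; exists x.
pose T' : ptopologicalType := HB.pack_for ptopologicalType T (isPointed.Build T x).
have : @compact T' A by [].
rewrite (compact_cover T') => /(_ I setT O) [i _|y Ay|s _ sA]; first exact: oO.
  by have [i Oi] := AO _ Ay; exists i.
by exists s => y /sA [i si Oi]; exists i.
Qed.

Section QuotientCover.
Local Open Scope quotient_scope.

Lemma quotient_finite_cover (T : topologicalType) (Y : Type) (f : T -> Y)
    (I : choiceType) (O : I -> set T) :
  compact [set: fiber_quotient f] ->
  (forall i, open [set x | exists2 y, O i y & f x = f y]) ->
  (forall x, exists i, O i x) ->
  exists s : seq I, forall x, exists i y, [/\ i \in s, O i y & f x = f y].
Proof.
move=> cQ oO cO.
pose V i := [set q : fiber_quotient f | exists2 y, O i y & f (repr q) = f y].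
have frepr (x : T) : f (repr (\pi_(fiber_quotient f) x)) = f x.
  have /eqmodP /asboolP : repr (\pi_(fiber_quotient f) x) = x
      %[mod {eq_quot same_fiber_equiv f}] by rewrite reprK.
  by [].
have [i|q _|s sV] := compact_finite_cover (O := V) cQ.
- rewrite /open /= /quotient_open (_ : _ @^-1` _ = [set x | exists2 y, O i y & f x = f y]) //.
  by apply/seteqP; split=> x [y Oy]; rewrite ?frepr => fxy; exists y; rewrite //= ?frepr.
- by have [i Oi] := cO (repr q); exists i => //; exists (repr q).
exists s => x; have [|i si [y Oy fxy]] := sV (\pi_(fiber_quotient f) x); first by [].
by exists i, y; split=> //; rewrite -fxy frepr.
Qed.

End QuotientCover.

(** * Geometric actions on proper geodesic spaces *)

Section MetricCase.
Local Open Scope ring_scope.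
Variables (R : realType) (X : metricType R).

(** In a geodesic space [reach adjacent r] is exactly the relation of being at distance at most r,
    so graph balls are the compact metric balls of integer radius. *)
Definition adjacent (x y : X) : Prop := mdist x y <= 1.

Lemma adjacent_refl x : adjacent x x.
Proof. by rewrite /adjacent mdistxx ler01. Qed.

Lemma adjacent_sym x y : adjacent x y -> adjacent y x.
Proof. by rewrite /adjacent metric_sym. Qed.

Lemma reach_mdist r x y : reach adjacent r x y -> mdist x y <= r%:R.
Proof.
elim: r x => [|r IH] x /=; first by move=> ->; rewrite mdistxx.
move=> [z xz /IH zy]; apply: le_trans (metric_triangle x z y) _.
by rewrite -natr1 addrC lerD.
Qed.

Hypothesis Xgeo : geodesic_space X.

Lemma mdist_reach r x y : mdist x y <= r%:R -> reach adjacent r x y.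
Proof.
move=> xyr; have [c [c0 cd cE]] := Xgeo x y.
set d := mdist x y in xyr cd cE.
have d0 : 0 <= d by apply: mdist_ge0.
have H k : reach adjacent k x (c (Num.min k%:R d)).
  elim: k => [|k IH]; first by rewrite /= (min_idPl d0) c0.
  rewrite -addn1; apply: reachD IH _; exists (c (Num.min k.+1%:R d));
    last by rewrite addn1.
  have m1 m : 0 <= Num.min (m%:R : R) d <= d.
    by rewrite le_min ler0n d0 ge_min lexx orbT.
  rewrite /adjacent cE //.
  have hk : (k%:R : R) <= k.+1%:R by rewrite ler_nat.
  rewrite -natr1 in hk *.
  rewrite ler_norml.
  by have [h1|h1] := leP (k%:R : R) d; have [h2|h2] := leP (k%:R + 1 : R) d;
    apply/andP; split; lra.
have := H r; by rewrite (min_idPr xyr) cd.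
Qed.

Lemma metric_dense (G : groupType) (act : G -> X -> X) (x0 : X) :
  acts_by_isometries act -> cocompact_action act ->
  exists D, forall D', (D <= D')%N -> forall x, exists g, reach adjacent D' (act g x0) x.
Proof.
move=> [[a1 aM] aI] cA.
pose O n := [set x | mdist x0 x < n%:R].
have eq_orbit x g : orbit_of act (act g x) = orbit_of act x.
  apply/seteqP; split=> _ [h _ <-].
    by exists (h * g)%g => //; rewrite aM.
  by exists (h * g^-1)%g => //; rewrite -aM -mulgA mulVg mulg1.
have inv_orbit x y : orbit_of act x = orbit_of act y -> exists g, act g x = y.
  by move=> e; have [g _ gx] : orbit_of act x y by [rewrite e; exists 1%g]; exists g.
have [n|x|s sP] := @quotient_finite_cover X _ (orbit_of act) _ O cA.
- rewrite openE => x [y Oy /inv_orbit[g gx]].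
  apply/nbhs_ballP; exists (n%:R - mdist x0 y); first by rewrite /= subr_gt0.
  move=> z; rewrite ballEmdist /= => xz; exists (act g z); last by rewrite eq_orbit.
  rewrite /O /=; apply: le_lt_trans (metric_triangle x0 y _) _.
  by rewrite -ltrBrDl -gx aI gx.
- have h0 : 0 <= mdist x0 x by apply: mdist_ge0.
  by exists (Num.bound (mdist x0 x)); apply: archi_boundP.
exists (\max_(i <- s) i) => D' DD' x; have [n [y [ns Oy /inv_orbit[g gx]]]] := sP x.
exists g^-1%g; apply: mdist_reach; rewrite -(aI g) -aM mulgV a1 gx.
apply/ltW/(lt_le_trans Oy); rewrite ler_nat; apply: leq_trans DD'.
exact: (@leq_bigmax_seq _ s xpredT id).
Qed.

Lemma metric_proper (G : groupType) (act : G -> X -> X) (x0 : X) r :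
  proper_space X -> acts_by_isometries act -> properly_discontinuous act ->
  finite_set [set g | reach adjacent r x0 (act g x0)].
Proof.
move=> Xp aI aP; apply: sub_finite_set (aP _ (Xp x0 r%:R)) => g /reach_mdist gr.
exists (act g x0); split=> //; exists x0 => //=.
by rewrite mdistxx.
Qed.

End MetricCase.

Lemma metric_lattice (R : realType) (X : metricType R) p (x0 : X)
    (act : free_product p -> X -> X) :
  proper_space X -> geodesic_space X -> acts_by_isometries act ->
  properly_discontinuous act -> cocompact_action act ->
  exists D ell kap, lattice_action (@adjacent R X) act x0 D ell kap.
Proof.
move=> Xp Xg aI aP aC; have [D DP] := metric_dense Xg x0 aI aC.
exists D; have [[a1 aM] aI'] := aI; apply: lattice_action_of => //.
- exact: adjacent_refl.
- exact: adjacent_sym.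
- move=> x y; exists (Num.bound (mdist x y)); apply: mdist_reach => //.
  by apply/ltW/archi_boundP/mdist_ge0.
- by move=> g x y; rewrite /adjacent aI'.
- exact: DP.
- by move=> r; apply: metric_proper.
Qed.

(** * Discrete cocompact representations *)

Section GroupCase.
Local Open Scope group_scope.
Variable L : topologicalGroupType.
Implicit Types (x y z : L) (K : set L).

(** The Cayley graph of L for K, with loops and both orientations. Left translations are
    automorphisms, so every representation into L acts on it. *)
Definition word_adjacent K x y : Prop :=
  [\/ x = y, K (x^-1 * y) | K (y^-1 * x)].

Lemma mull_continuous x : continuous (fun y => x * y).
Proof.
move=> y; apply: (@continuous_comp _ _ _ (fun y => (x, y)) (fun u : L * L => u.1 * u.2)).
  by apply: cvg_pair; [exact: cvg_cst|exact: cvg_id].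
exact: mulg_continuous.
Qed.

Lemma mulr_continuous x : continuous (fun y => y * x).
Proof.
move=> y; apply: (@continuous_comp _ _ _ (fun y => (y, x)) (fun u : L * L => u.1 * u.2)).
  by apply: cvg_pair; [exact: cvg_id|exact: cvg_cst].
exact: mulg_continuous.
Qed.

Lemma compact_mulg K K' : compact K -> compact K' ->
  compact [set z | exists2 u, (K `*` K') u & z = u.1 * u.2].
Proof.
move=> cK cK'; have := continuous_compact
  (continuous_subspaceT (@mulg_continuous L)) (compact_setX cK cK').
rewrite (_ : _ @` _ = [set z | exists2 u, (K `*` K') u & z = u.1 * u.2]) //.
by apply/seteqP; split=> z [u Ku e]; exists u.
Qed.

Lemma compact_invg K : compact K -> compact ((fun x => x^-1) @` K).
Proof.
move=> cK; exact: (continuous_compact (continuous_subspaceT (@invg_continuous L)) cK).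
Qed.

Lemma nbhs_mull x y (U : set L) : nbhs (x * y) U -> nbhs y [set z | U (x * z)].
Proof. exact: mull_continuous. Qed.

Lemma nbhs_mulr x y (U : set L) : nbhs (y * x) U -> nbhs y [set z | U (z * x)].
Proof. exact: mulr_continuous. Qed.

Fixpoint word_ball K r : set L :=
  if r is r'.+1 then
    [set z | exists2 u, ((K `|` (fun x => x^-1) @` K) `*` word_ball K r') u
                      & z = u.1 * u.2]
  else [set 1].

Lemma word_ball_compact K r : compact K -> compact (word_ball K r).
Proof.
move=> cK; elim: r => [|r IH]; first exact: compact_set1.
by apply: compact_mulg => //; apply: compactU => //; apply: compact_invg.
Qed.

Lemma reach_word_ball K r x y : K 1 ->
  reach (word_adjacent K) r x y -> word_ball K r (x^-1 * y).
Proof.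
move=> K1; elim: r x => [|r IH] x /=; first by move=> ->; rewrite mulVg.
move=> [z xz /IH zy]; exists (x^-1 * z, z^-1 * y); last first.
  by rewrite /= mulgA mulgK.
split=> //=; case: xz => [->|?|Kzx]; [by left; rewrite mulVg|by left|right].
by exists (z^-1 * x) => //; rewrite invgM invgK.
Qed.

(** Take W with W^-1 W inside a neighbourhood of 1 that meets the image in 1 only. Elements with
    images in one translate of W differ by the finite kernel, and finitely many translates cover
    C. *)
Lemma discrete_finite (G : groupType) (rho : UMagmaMorphism.type G L) C :
  discrete_subgroup (range rho) -> virtually_faithful rho -> compact C ->
  finite_set [set g | C (rho g)].
Proof.
move=> dis vf cC.
have [|_ [V V1 VH]] := dis 1; first by exists 1 => //; rewrite gmulf1.
have : nbhs (1 : L, 1 : L) [set u : L * L | V (u.1^-1 * u.2)].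
  have ct : {for (1 : L, 1 : L), continuous (fun u : L * L => u.1^-1 * u.2)}.
    apply: (@continuous_comp _ _ _ (fun u : L * L => (u.1^-1, u.2))
              (fun u : L * L => u.1 * u.2)); last exact: mulg_continuous.
    apply: cvg_pair; last exact: cvg_snd.
    apply: (@continuous_comp _ _ _ fst (fun x : L => x^-1)); first exact: cvg_fst.
    exact: invg_continuous.
  by apply: ct; rewrite /= invg1 mulg1.
case=> -[W1 W2] [/= nW1 nW2] W12.
pose W := (W1 `&` W2)^°.
have oW : open W by apply: open_interior.
have W1' : W 1 by apply: filterI.
have WV x y : W x -> W y -> V (x^-1 * y).
  move=> /interior_subset[Wx _] /interior_subset[_ Wy].
  exact: (W12 (x, y)).
pose O c := [set x | W (c^-1 * x)].
have [c|x Cx|s sC] := compact_finite_cover (O := O) cC.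
- rewrite openE => x Ox; apply: nbhs_mull; exact: open_nbhs_nbhs.
- by exists x; rewrite /O /= mulVg.
have fin c : finite_set [set g | O c (rho g)].
  have [[g0 Og0]|n] := pselect (exists g, O c (rho g)); last first.
    by apply: (@sub_finite_set _ _ set0) => // g Og; apply: n; exists g.
  apply: (@sub_finite_set _ _ ((fun k => g0 * k) @` [set k | rho k = 1])).
    move=> g Og; exists (g0^-1 * g); last by rewrite mulVKg.
    have := WV _ _ Og0 Og; rewrite invgM invgK -mulgA mulVKg => Vg.
    have : (V `&` range rho) (rho (g0^-1 * g)).
      by split; [rewrite gmulfM gmulfV|exists (g0^-1 * g)].
    by rewrite VH.
  exact: finite_image.
apply: (@sub_finite_set _ _ (\bigcup_(c in [set` s]) [set g | O c (rho g)])).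
  by move=> g /sC[c cs Oc]; exists c.
by apply: bigcup_finite => //; apply: finite_finset.
Qed.

Lemma cocompact_compact (H : set L) : locally_compact [set: L] ->
  H 1 -> (forall x, H x -> H x^-1) -> (forall x y, H x -> H y -> H (x * y)) ->
  cocompact_subgroup H ->
  exists2 K, compact K & forall x, exists k h, [/\ K k, H h & x = k * h].
Proof.
move=> lc H1 HV HM cH.
have [N nN [cN _]] := lc 1 I.
have {}nN : nbhs (1 : L) N.
  rewrite (_ : N = [set x | [set: L] x -> N x]); first exact: nN.
  by apply/seteqP; split=> [x Nx _ //|x]; exact.
pose O c := [set x | N^° (c^-1 * x)].
have cosetP x y : left_coset H x = left_coset H y <-> H (y^-1 * x).
  split=> [e|h].
    have [h Hh <-] : left_coset H y x by rewrite -e; exists 1; rewrite ?mulg1.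
    by rewrite mulKg.
  apply/seteqP; split=> _ [k Hk <-].
    by exists (y^-1 * x * k); [exact: HM|rewrite mulgA mulVKg].
  exists (x^-1 * y * k); last by rewrite mulgA mulVKg.
  by apply: HM => //; have := HV _ h; rewrite invgM invgK.
have [c|x|s sP] := @quotient_finite_cover L _ (left_coset H) _ O cH.
- rewrite openE => x [y Oy /cosetP yx].
  have : nbhs (x * (x^-1 * y)) (O c).
    rewrite mulVKg; apply: nbhs_mull; apply: open_nbhs_nbhs; split=> //.
    exact: open_interior.
  move/nbhs_mulr; apply: filterS => z Oz; exists (z * (x^-1 * y)) => //.
  by apply/cosetP; rewrite invgM mulgVK invgM invgK.
- by exists x; rewrite /O /= mulVg.
exists (\big[setU/set0]_(c <- s) [set x | exists2 u, ([set c] `*` N) u & x = u.1 * u.2]).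
  by apply: bigsetU_compact => c _; apply: compact_mulg => //; apply: compact_set1.
move=> x; have [c [y [cs /interior_subset Ny /cosetP yx]]] := sP x.
exists y, (y^-1 * x); split=> //; last by rewrite mulVKg.
rewrite -bigcup_seq; exists c => //.
by exists (c, c^-1 * y) => //=; rewrite mulVKg.
Qed.

End GroupCase.

(** Allowing every compact K above [K0] lets two representations share the graph of the union of
    their sets. [K0] contains a set meeting all cosets, hence the density 1, and the images of the
    syllables, hence connectedness. *)
Lemma group_lattice (L : topologicalGroupType) p
    (rho : UMagmaMorphism.type (free_product p) L) :
  locally_compact [set: L] -> discrete_cocompact_rep rho -> virtually_faithful rho ->
  exists2 K0, compact K0 & forall K, K0 `<=` K -> compact K ->
    exists ell kap, lattice_action (word_adjacent K)
      (fun g x => rho g * x)%g 1%g 1 ell kap.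
Proof.
move=> lc [dis coc] vf.
have [||||K1 cK1 K1P] := @cocompact_compact L (range rho) lc.
- by exists 1%g => //; rewrite gmulf1.
- by move=> _ [g _ <-]; exists g^-1%g => //; rewrite gmulfV.
- by move=> _ _ [g _ <-] [h _ <-]; exists (g * h)%g => //; rewrite gmulfM.
- exact: coc.
pose S := (fun a : option (syllable p) => if a is Some a then rho (syl a) else 1%g) @` setT.
have cS : compact S.
  by apply: finite_compact; apply: finite_image; exact: finite_finset.
exists (K1 `|` S); first exact: compactU.
move=> K KK cK; have KS a : K (rho (syl a)) by apply: KK; right; exists (Some a).
have K_1 : K 1%g by apply: KK; right; exists None.
have Es x y : word_adjacent K x y -> word_adjacent K y x.
  by case=> [->|?|?]; [constructor 1|constructor 3|constructor 2].
have Er x : word_adjacent K x x by constructor 1.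
have dense x : exists g, word_adjacent K (rho g) x.
  (* With H the image, cocompactness writes L as K1 H, whereas left translation calls for H K1^-1;
     hence the inverse of x. *)
  have [k [_ [Kk [h _ <-] e]]] := K1P x^-1%g; exists h^-1%g; constructor 3.
  by rewrite gmulfV e mulgK; apply: KK; left.
have con1 x : exists r, reach (word_adjacent K) r 1%g x.
  have [g gx] := dense x; suff [r rg] : exists r, reach (word_adjacent K) r 1%g (rho g).
    by exists (r + 1)%N; apply: reachD rg _; exists x.
  elim/fp_ind: g {gx} => [|g a [r rg]]; first by exists 0%N; rewrite gmulf1.
  exists (r + 1)%N; apply: reachD rg _; exists (rho (g * syl a)%g) => //.
  by constructor 2; rewrite gmulfM mulKg; apply: KS.
apply: lattice_action_of => //.
- move=> x y; have [r rx] := con1 x; have [s sy] := con1 y.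
  by exists (r + s)%N; apply: reachD sy; apply: reach_sym.
- by move=> x; rewrite gmulf1 mul1g.
- by move=> g h x; rewrite gmulfM mulgA.
- move=> g x y; case=> [->|Kxy|Kyx]; [by constructor 1|constructor 2|constructor 3];
  by rewrite invgM -mulgA mulKg.
- by move=> x; have [g gx] := dense x; exists g; exists x; rewrite // mulg1.
move=> r; apply: (@sub_finite_set _ _ [set g | word_ball K r (rho g)]); last first.
  exact: (discrete_finite dis vf (word_ball_compact cK)).
by move=> g; rewrite /mkset mulg1 => /(reach_word_ball K_1); rewrite invg1 mul1g.
Qed.

Lemma no_common_space (R : realType) (p q : nat) :
  prime p -> prime q -> (2 < p)%N -> (2 < q)%N -> p <> q ->
  ~ (exists X : metricType R,
       [/\ [set: X] !=set0, proper_space X, geodesic_space X,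
           exists act : free_product p -> X -> X,
             [/\ acts_by_isometries act, properly_discontinuous act
               & cocompact_action act]
         & exists act : free_product q -> X -> X,
             [/\ acts_by_isometries act, properly_discontinuous act
               & cocompact_action act]]).
Proof.
move=> pp pq p2 q2 npq [X [[x0 _] Xp Xg [act [aI aP aC]] [act' [aI' aP' aC']]]].
have [D [ell [kap H]]] := metric_lattice x0 Xp Xg aI aP aC.
have [D' [ell' [kap' H']]] := metric_lattice x0 Xp Xg aI' aP' aC'.
exact: (no_common_lattice pp pq p2 q2 npq H H').
Qed.

Lemma no_common_group (p q : nat) :
  prime p -> prime q -> (2 < p)%N -> (2 < q)%N -> p <> q ->
  ~ (exists L : topologicalGroupType,
       [/\ locally_compact [set: L],
           exists rho : UMagmaMorphism.type (free_product p) L,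
             discrete_cocompact_rep rho /\ virtually_faithful rho
         & exists rho' : UMagmaMorphism.type (free_product q) L,
             discrete_cocompact_rep rho' /\ virtually_faithful rho']).
Proof.
move=> pp pq p2 q2 npq [L [lc [rho [dc vf]] [rho' [dc' vf']]]].
have [K cK HK] := group_lattice lc dc vf.
have [K' cK' HK'] := group_lattice lc dc' vf'.
have cKK := compactU cK cK'.
have [|ell [kap H]] := HK _ _ cKK; first by left.
have [|ell' [kap' H']] := HK' _ _ cKK; first by right.
exact: (no_common_lattice pp pq p2 q2 npq H H').
Qed.

(** * Quasi-isometry with free groups *)

Lemma word_normE (G : groupType) (S : seq G) (len : G -> nat) :
  len 1%g = 0 -> 
  (forall x g, (x \in S) || (x^-1%g \in S) -> len (x * g)%g <= (len g).+1) ->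
  (forall g, spelled_in S (len g) g) ->
  forall g, word_norm S g = len g.
Proof.
move=> len1 lenS lenP g.
have H k h : spelled_in S k h -> len h <= k.
  move=> [w [ww <- <-]]; elim: w ww => [|x w IH] /=; first by rewrite big_nil len1.
  by move=> /andP[xS /IH ww]; rewrite big_cons; apply: leq_trans (lenS _ _ xS) _.
apply: xget_unique; first by split=> // j /H.
by move=> k [kg kmin]; apply/eqP; rewrite eqn_leq H // kmin.
Qed.

Section NatQuasiIsometry.

Definition nat_qi (X Y : Type) (dX : X -> X -> nat) (dY : Y -> Y -> nat)
    (f : X -> Y) (K C : nat) : Prop :=
  [/\ 0 < K,
      forall x x', dX x x' <= K * dY (f x) (f x') + C,
      forall x x', dY (f x) (f x') <= K * dX x x' + C
    & forall y, exists x, dY (f x) y <= C].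

(** The map h is f followed by a coarse inverse of g. Thus two groups need only be compared with the
    binary tree, not with each other. *)
Lemma nat_qi_cospan (X Y Z : Type) dX dY dZ (f : X -> Z) (g : Y -> Z) K C K' C' :
  (forall x y, dZ x y = dZ y x) ->
  (forall x y z, dZ x z <= dZ x y + dZ y z) ->
  @nat_qi X Z dX dZ f K C -> @nat_qi Y Z dY dZ g K' C' ->
  exists h K'' C'', @nat_qi X Y dX dY h K'' C''.
Proof.
move=> sZ tZ [K0 f1 f2 f3] [K0' g1 g2 g3].
have [h hP] := choice (fun x => g3 (f x)).
exists h, (K * K'), (K * (3 * C') + K' * (C + 2 * C') + C + C').
have lo x x' : dZ (f x) (f x') <= dZ (g (h x)) (g (h x')) + 2 * C'.
  have := tZ (f x) (g (h x)) (f x'); have := tZ (g (h x)) (g (h x')) (f x').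
  have := hP x; have := hP x'; rewrite (sZ (f x) (g (h x))); lia.
have hi x x' : dZ (g (h x)) (g (h x')) <= dZ (f x) (f x') + 2 * C'.
  have := tZ (g (h x)) (f x) (g (h x')); have := tZ (f x) (f x') (g (h x')).
  have := hP x; have := hP x'; rewrite (sZ (f x') (g (h x'))); lia.
split; first by rewrite muln_gt0 K0.
- move=> x x'; have := f1 x x'; have := lo x x'; have := g2 (h x) (h x'); nia.
- move=> x x'; have := g1 (h x) (h x'); have := hi x x'; have := f2 x x'; nia.
move=> y; have [x fx] := f3 (g y); exists x.
have := g1 (h x) y; have := tZ (g (h x)) (f x) (g y); have := hP x; nia.
Qed.

Local Open Scope ring_scope.

Lemma nat_qi_real (R : realType) (X Y : Type) dX dY (f : X -> Y) K C :
  nat_qi dX dY f K C ->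
  quasi_isometric (fun x x' => (dX x x')%:R : R) (fun y y' => (dY y y')%:R).
Proof.
move=> [K0 f1 f2 f3]; exists f, K%:R, C%:R; split.
- by rewrite ler1n.
- by rewrite ler0n.
- move=> x x'; apply/andP; split; last by rewrite -natrM -natrD ler_nat.
  have K0R : (0 : R) < K%:R by rewrite ltr0n.
  rewrite lerBlDr ler_pdivrMl //.
  apply: le_trans (_ : (K * dY (f x) (f x') + C)%:R <= _); first by rewrite ler_nat.
  by rewrite natrD natrM mulrDr lerD2l -natrM ler_nat leq_pmull.
by move=> y; have [x fx] := f3 y; exists x; rewrite ler_nat.
Qed.

End NatQuasiIsometry.

(** * Trees of words and their binary encoding *)

Section TreeDistance.
Variable T : eqType.
Implicit Types (u v w : seq T).

(** The path metric of the rooted tree whose vertices are words: what is left of both after deleting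
    the common prefix. *)
Fixpoint tree_dist u v : nat :=
  match u, v with
  | a :: u', b :: v' => if a == b then tree_dist u' v' else size u + size v
  | _, _ => size u + size v
  end.

Lemma tree_dist_nil u : tree_dist u [::] = size u.
Proof. by case: u => //= a u; rewrite addn0. Qed.

Lemma tree_dist_sym u v : tree_dist u v = tree_dist v u.
Proof.
elim: u v => [|a u IH] [|b v] //=; rewrite ?addn0 // eq_sym.
by case: eqP => // _; rewrite addnC.
Qed.

Lemma tree_dist_le u v : tree_dist u v <= size u + size v.
Proof.
elim: u v => [|a u IH] [|b v] //=; case: eqP => // _.
by apply: leq_trans (IH v) _; lia.
Qed.

Lemma size_tree_dist u v : size u <= tree_dist u v + size v.
Proof.
elim: u v => [|a u IH] [|b v] //=; first by lia.
case: eqP => // _; first by have := IH v; lia.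
lia.
Qed.

Lemma tree_dist_triangle u v w : tree_dist u w <= tree_dist u v + tree_dist v w.
Proof.
elim: u v w => [|a u IH] v w.
  by rewrite -[tree_dist [::] w]/(size w) -[tree_dist [::] v]/(size v)
    (tree_dist_sym v) addnC size_tree_dist.
case: w => [|c w]; first by rewrite !tree_dist_nil size_tree_dist.
case: v => [|b v]; first by rewrite tree_dist_nil tree_dist_le.
have IHvw := IH v w; have uv := size_tree_dist u v; have uw := tree_dist_le u w.
have := size_tree_dist w v; rewrite (tree_dist_sym w) => wv.
rewrite /=; have [ab|ab] := eqVneq a b; have [bc|bc] := eqVneq b c.
- by rewrite ab bc eqxx.
- by rewrite ab (negbTE bc); lia.
- by rewrite -bc (negbTE ab); lia.
- by case: eqP => _; lia.
Qed.

Lemma tree_dist_cat c u v : tree_dist (c ++ u) (c ++ v) = tree_dist u v.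
Proof. by elim: c => //= a c IH; rewrite eqxx. Qed.

End TreeDistance.

(** The truncated unary code with k codewords: i times [true], then [false], except that the last
    one stops after k - 1 times [true]. These are the leaves of a binary caterpillar, so no codeword
    is a prefix of another and every long enough binary word starts with one. *)
Fixpoint unary_code (k i : nat) : seq bool :=
  if k is k'.+1 then
    if k' == 0 then [::] else
    if i is i'.+1 then true :: unary_code k' i' else [:: false]
  else [::].

Lemma size_unary_code k i : size (unary_code k i) <= k.
Proof. by elim: k i => //= k IH [|i]; case: eqP => //= _; exact: IH. Qed.

Lemma unary_code_gt0 k i : 1 < k -> 0 < size (unary_code k i).
Proof. by case: k => //= -[|k] // _; case: i. Qed.

Lemma unary_code_prefix_free k i j (s t : seq bool) : i < k -> j < k -> i != j ->
  size (unary_code k i ++ s) + size (unary_code k j ++ t) <=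
  tree_dist (unary_code k i ++ s) (unary_code k j ++ t) + 2 * k.
Proof.
elim: k i j => //= k IH [|i] [|j] //; rewrite ?ltnS => ik jk ij.
- by rewrite (_ : (k == 0) = false) /=; lia.
- by rewrite (_ : (k == 0) = false) /=; lia.
- by rewrite (_ : (k == 0) = false) /=; [have := IH _ _ ik jk ij; lia|lia].
Qed.

Lemma unary_code_complete k (s : seq bool) : 0 < k ->
  (exists i t, i < k /\ s = unary_code k i ++ t) \/ size s < k.
Proof.
elim: k s => // k IH s _; case: (posnP k) => [->|k0]; first by left; exists 0, s.
rewrite /= gtn_eqF //; case: s => [|[] s]; [by right| |by left; exists 0, s].
have [[i [t [ik ->]]]|] := IH s k0; last by right.
by left; exists i.+1, t.
Qed.

Section WordTrees.
Variables (T : finType) (ok : option T -> pred T).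

Fixpoint tree_word (o : option T) (w : seq T) : bool :=
  if w is b :: w' then ok o b && tree_word (Some b) w' else true.

Definition children (o : option T) : seq T := [seq b <- enum T | ok o b].

(** Replaces the star formed by a vertex and its children by a binary caterpillar; this distorts
    distances boundedly when every vertex has between 2 and N children. *)
Fixpoint encode (o : option T) (w : seq T) : seq bool :=
  if w is b :: w' then
    unary_code (size (children o)) (index b (children o)) ++ encode (Some b) w'
  else [::].

Variable N : nat.
Hypothesis children_bounds : forall o, 1 < size (children o) <= N.

Lemma two_children o : 1 < size (children o).
Proof. by case/andP: (children_bounds o). Qed.

Lemma size_children o : size (children o) <= N.
Proof. by case/andP: (children_bounds o). Qed.

Lemma mem_children o b : (b \in children o) = ok o b.
Proof. by rewrite mem_filter mem_enum andbT. Qed.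

Lemma size_encode o w : size w <= size (encode o w) <= N * size w.
Proof.
elim: w o => //= b w IH o; rewrite size_cat.
have := unary_code_gt0 (index b (children o)) (two_children o).
have := size_unary_code (size (children o)) (index b (children o)).
have /andP[lo hi] := IH (Some b) => hk h0; apply/andP; split; first by lia.
by rewrite mulnS leq_add // (leq_trans hk (size_children o)).
Qed.

(** Each letter costs between 1 and N bits. At the branching vertex the two codewords may still
    share up to N bits, which shortens the path by at most 2 N. *)
Lemma encode_dist o u v : tree_word o u -> tree_word o v ->
  tree_dist u v <= tree_dist (encode o u) (encode o v) + 2 * N /\
  tree_dist (encode o u) (encode o v) <= N * tree_dist u v.
Proof.
elim: u v o => [|a u IH] v o; first by have := size_encode o v; rewrite /=; lia.
case: v => [|b v].
  rewrite [encode o [::]]/= !tree_dist_nil; have /andP[lo hi] := size_encode o (a :: u).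
  by move=> _ _; split; [exact: leq_trans lo (leq_addr _ _)|].
move=> /= /andP[oa ru] /andP[ob rv]; have [ab|ab] := eqVneq a b.
  by subst b; rewrite tree_dist_cat; apply: IH.
have := @unary_code_prefix_free (size (children o)) (index a (children o))
  (index b (children o)) (encode (Some a) u) (encode (Some b) v).
rewrite !index_mem !mem_children => /(_ oa ob).
have -> : index a (children o) != index b (children o).
  apply: contra ab => /eqP e; have := @nth_index _ a b (children o).
  by rewrite -e nth_index ?mem_children // => ->.
move=> /(_ isT); have := size_children o.
have := size_encode o (a :: u); have := size_encode o (b :: v).
have := tree_dist_le (encode o (a :: u)) (encode o (b :: v)).
rewrite /=; nia.
Qed.

(** Greedy decoding: by completeness of the code it stops only when the remainder is shorter than
    the number of children. *)
Lemma encode_dense o s : exists u, tree_word o u /\ tree_dist (encode o u) s <= N.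
Proof.
have [n] := ubnP (size s); elim: n s o => // n IH s o sn.
have [[i [t [ik st]]]|sk] := unary_code_complete s (ltnW (two_children o)).
  have := unary_code_gt0 i (two_children o) => c0.
  have [b0 _] : exists b0 : T, true.
    by case: (children o) ik => // b0 _ _; exists b0.
  pose b := nth b0 (children o) i.
  have tn : size t < n by rewrite -ltnS (leq_trans _ sn) // ltnS st size_cat -[X in X < _]add0n ltn_add2r.
  have [u [ru ut]] := IH t (Some b) tn.
  exists (b :: u); rewrite /= ru -mem_children mem_nth //; split=> //.
  have ib : index b (children o) = i by rewrite index_uniq // filter_uniq ?enum_uniq.
  by rewrite st ib tree_dist_cat.
exists [::]; split=> //=; rewrite add0n; apply: ltnW.
exact: leq_trans sk (size_children o).
Qed.

End WordTrees.

Section EncodeQI.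
Variables (T : finType) (ok : option T -> pred T) (G : Type) (word : G -> seq T).
Variables (dG : G -> G -> nat) (c : nat).
Variable N : nat.
Hypothesis children_bounds : forall o, 1 < size (children ok o) <= N.
Hypothesis word_ok : forall g, tree_word ok None (word g).
Hypothesis word_surj : forall w, tree_word ok None w -> exists g, word g = w.
Hypothesis dG_le : forall g h, dG g h <= tree_dist (word g) (word h).
Hypothesis dG_ge : forall g h, tree_dist (word g) (word h) <= dG g h + c.

Lemma encode_qi : exists f K C, nat_qi dG (@tree_dist bool) f K C.
Proof.
pose code g := encode ok None (word g).
exists code, N.+1, (2 * N + N.+1 * c); split=> //.
- move=> g h; have [e _] := encode_dist children_bounds (word_ok g) (word_ok h).
  apply: leq_trans (dG_le g h) _; apply: leq_trans e _.
  by apply: leq_add; [exact: leq_pmull|exact: leq_addr].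
- move=> g h; have [_ e] := encode_dist children_bounds (word_ok g) (word_ok h).
  apply: leq_trans e _; apply: (@leq_trans (N.+1 * (dG g h + c))).
    exact: leq_mul (leqnSn _) (dG_ge g h).
  by rewrite mulnDr addnCA leq_addl.
move=> s; have [u [/word_surj[g <-] us]] := encode_dense children_bounds None s.
exists g; apply: leq_trans us _; lia.
Qed.

End EncodeQI.

Lemma children_boundsP (T : finType) (ok : option T -> pred T) :
  (forall o, exists a b, [/\ a != b, ok o a & ok o b]) ->
  forall o, 1 < size (children ok o) <= size (enum T).
Proof.
move=> h o; have [a [b [ab oa ob]]] := h o; rewrite size_filter count_size andbT.
have : size [:: a; b] <= size (children ok o).
  apply: uniq_leq_size; first by rewrite /= inE ab.
  by move=> x; rewrite !inE mem_children => /orP[] /eqP ->.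
by rewrite size_filter.
Qed.

(** * Free products of two cyclic groups as trees of words *)

Section FreeProductTree.
Variable p : nat.
Hypothesis two_neq0 : (2%:R : 'F_p)%R != 0%R.
Local Notation G := (free_product p).

Definition syl_ok (o : option (syllable p)) : pred (syllable p) :=
  fun b => (b.2 != 0%R) && (if o is Some a then a.1 != b.1 else true).

Lemma alternatingE w : alternating w = tree_word syl_ok None w.
Proof.
have H a v : alternating (a :: v) = (a.2 != 0%R) && tree_word syl_ok (Some a) v.
  elim: v a => [|b v IH] a; first by rewrite alternating_cons /= andbT.
  by rewrite alternating_cons IH /= /syl_ok /= -!andbA; do !bool_congr.
by case: w => // a v; rewrite H /= /syl_ok /= andbT.
Qed.

Definition fp_gens : seq G := [seq syl a | a <- enum {: syllable p}].

Lemma fp_spelled (g : G) : spelled_in fp_gens (flen g) g.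
Proof.
exists [seq syl a | a <- syl_of g]; split.
- apply/allP => x /mapP[a _ ->]; rewrite map_f ?mem_enum //.
- by rewrite size_map.
case: g => w rw; apply: val_inj; rewrite big_map /=.
elim: w rw => [|a w IH] raw; first by rewrite big_nil.
have rw := alternating_behead raw.
rewrite big_cons -[LHS]/(smul (spush a [::]) (syl_of (\prod_(j <- w) syl j)%g)).
rewrite (IH rw) /spush (_ : (a.2 == 0%R) = false) /= ?spush_cons //.
by move: raw; rewrite alternating_cons => /andP[/negbTE].
Qed.

Lemma fp_word_norm (g : G) : word_norm fp_gens g = flen g.
Proof.
apply: word_normE; [by []| |exact: fp_spelled].
move=> x h xS; have x1 : flen x <= 1.
  by case/orP: xS => /mapP[a _]; [|rewrite -flenV]; move=> ->; apply: flen_syl.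
by apply: leq_trans (flenM x h) _; rewrite -add1n leq_add2r.
Qed.

Lemma fp_generates : generates fp_gens.
Proof. by move=> g; exists (flen g); apply: fp_spelled. Qed.

Lemma fp_dist_le (g h : G) : flen (g^-1 * h)%g <= tree_dist g h.
Proof.
case: g h => u ru [v rv]; elim: u v ru rv => [|a u IH] v ru rv.
  have -> : (FreeProduct ru)^-1%g = 1%g.
    by apply/eqP; rewrite invg_eq1; apply/eqP/val_inj.
  by rewrite mul1g.
case: v rv => [|b v] rv.
  by rewrite tree_dist_nil (_ : FreeProduct rv = 1%g) ?mulg1 ?flenV //; apply: val_inj.
rewrite /=; case: eqP => [ab|_]; last first.
  by apply: leq_trans (flenM _ _) _; rewrite flenV.
subst b; have ru' := alternating_behead ru; have rv' := alternating_behead rv.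
have E w (r : alternating (a :: w)) (r' : alternating w) :
    FreeProduct r = (syl a * FreeProduct r')%g.
  apply: val_inj; rewrite -[RHS]/(smul (spush a [::]) w) /spush.
  rewrite (_ : (a.2 == 0%R) = false) /= ?spush_cons //.
  by move: r; rewrite alternating_cons => /andP[/negbTE].
by rewrite (E _ ru ru') (E _ rv rv') invgM -mulgA mulKg; apply: IH.
Qed.

(** Different first syllables of the same factor merge into one, so the length may drop below the
    tree distance; the 2 pays for the two syllables at the branching vertex. *)
Lemma fp_dist_ge (g h : G) : tree_dist g h <= flen (g^-1 * h)%g + 2.
Proof.
case: g h => u ru [v rv]; elim: u v ru rv => [|a u IH] v ru rv.
  have -> : (FreeProduct ru)^-1%g = 1%g.
    by apply/eqP; rewrite invg_eq1; apply/eqP/val_inj.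
  by rewrite mul1g leq_addr.
case: v rv => [|b v] rv.
  by rewrite tree_dist_nil (_ : FreeProduct rv = 1%g) ?mulg1 ?flenV ?leq_addr //; apply: val_inj.
have a0 : a.2 == 0%R = false.
  by move: ru; rewrite alternating_cons => /andP[/negbTE].
have E w (r : alternating (a :: w)) (r' : alternating w) :
    FreeProduct r = (syl a * FreeProduct r')%g.
  by apply: val_inj; rewrite -[RHS]/(smul (spush a [::]) w) /spush a0 /= spush_cons.
have ru' := alternating_behead ru.
rewrite /=; case: eqP => [ab|ab].
  subst b; have rv' := alternating_behead rv.
  by rewrite (E _ ru ru') (E _ rv rv') invgM -mulgA mulKg; apply: IH.
have sa : syl_of (syl a) = [:: a] by rewrite /= /spush a0.
have f0 : 0 < flen (syl a) by rewrite /flen sa.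
have := flen_prefix (w := syl a) (g := FreeProduct ru) (h := FreeProduct rv) f0.
rewrite !sa /= eqxx (introF eqP ab) prefix0s => /(_ isT isT) ->.
have sub1 (w : seq (syllable p)) c (r : alternating (c :: w)) :
    size w <= flen ((syl a)^-1 * FreeProduct r)%g.
  by apply: leq_trans (flen_sub _ _); rewrite /flen sa /= subn1.
by rewrite addSn addnS -addn2 leq_add2r leq_add.
Qed.

Lemma fp_qi : exists f K C,
  nat_qi (fun g h : G => word_norm fp_gens (g^-1 * h)%g) (@tree_dist bool) f K C.
Proof.
have one0 : (1 : 'F_p)%R != 0%R by rewrite oner_eq0.
apply: (@encode_qi _ syl_ok G (@syl_of p) _ 2 (size (enum {: syllable p}))).
- apply: children_boundsP => o.
  pose s := if o is Some a then ~~ a.1 else true.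
  have os : (if o is Some a then a.1 != s else true) = true.
    by rewrite /s; case: (o) => // a; case: a.1.
  (* Two children exist because 1 and -1 differ; with factors Z/2 the tree would not branch below
     its root. *)
  exists (s, 1%R), (s, (-1)%R); rewrite /syl_ok /= oppr_eq0 one0 os; split=> //.
  by rewrite xpair_eqE eqxx /= -subr_eq0 opprK -mulr2n.
- by move=> g; rewrite -alternatingE syl_ofP.
- by move=> w; rewrite -alternatingE => rw; exists (FreeProduct rw).
- by move=> g h; rewrite fp_word_norm fp_dist_le.
- by move=> g h; rewrite fp_word_norm fp_dist_ge.
Qed.

End FreeProductTree.

(** * Free groups as trees of words *)

Section FreeGroupTree.
Variable n : nat.
Hypothesis n_gt1 : 1 < n.
Local Notation F := (free_group n).

Definition letter_ok (o : option (letter n)) : pred (letter n) :=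
  fun b => if o is Some a then b != letterV a else true.

Lemma reducedE w : reduced w = tree_word letter_ok None w.
Proof.
have H a v : reduced (a :: v) = tree_word letter_ok (Some a) v.
  by elim: v a => //= b v IH a; rewrite -IH.
by case: w => // a v; rewrite H.
Qed.

Definition gen (a : letter n) : F := FreeGroup (push_reduced a (word_ofP 1%g)).

Definition free_gens : seq F := [seq gen a | a <- enum {: letter n}].

Lemma push_cons (a : letter n) w : reduced (a :: w) -> push a w = a :: w.
Proof. by case: w => //= b w /andP[/negbTE ->]. Qed.

Lemma size_push (a : letter n) w : size (push a w) <= (size w).+1.
Proof. by case: w => //= b w; case: ifP => //= _; apply: leqW. Qed.

Lemma gen_cons a w (r : reduced (a :: w)) (r' : reduced w) :
  FreeGroup r = (gen a * FreeGroup r')%g.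
Proof. by apply: val_inj; rewrite -[RHS]/(push a w) push_cons. Qed.

Lemma size_free_mul (g h : F) : size (g * h)%g <= size g + size h.
Proof.
rewrite -[syl in size syl <= _]/(word_mul g h).
elim: (word_of g) => //= a u IH.
by apply: leq_trans (size_push _ _) _; rewrite addSn ltnS.
Qed.

Lemma size_free_inv (g : F) : size (g^-1)%g = size g.
Proof. by rewrite -[LHS]/(size (word_inv g)) /word_inv size_rev size_map. Qed.

Lemma free_spelled (g : F) : spelled_in free_gens (size g) g.
Proof.
exists [seq gen a | a <- word_of g]; split.
- by apply/allP => x /mapP[a _ ->]; rewrite map_f ?mem_enum.
- by rewrite size_map.
case: g => w rw; rewrite big_map /=.
elim: w rw => [|a w IH] raw; first by rewrite big_nil; apply: val_inj.
have rw : reduced w by move: raw => /path_sorted.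
by rewrite big_cons (gen_cons raw rw) IH.
Qed.

Lemma free_word_norm (g : F) : word_norm free_gens g = size g.
Proof.
apply: (@word_normE _ _ (fun g : F => size g)); [by []| |exact: free_spelled].
move=> x h xS; have x1 : size x <= 1.
  by case/orP: xS => /mapP[a _]; [|rewrite -size_free_inv]; move=> ->.
by apply: leq_trans (size_free_mul x h) _; rewrite -add1n leq_add2r.
Qed.

Lemma word_mul_reduced_cat (u v : seq (letter n)) :
  reduced (u ++ v) -> word_mul u v = u ++ v.
Proof.
elim: u => //= a u IH r; rewrite IH ?push_cons //; exact: path_sorted r.
Qed.

Lemma reduced_join (u v : seq (letter n)) a b :
  reduced (rcons u a ++ b :: v) = [&& reduced (rcons u a), reduced (b :: v) & b != letterV a].
Proof.
rewrite /reduced; case: u => [|c u] /=; first by rewrite andbC.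
by rewrite cat_path last_rcons /= andbA andbAC -andbA.
Qed.

Lemma free_dist (g h : F) : size (g^-1 * h)%g = tree_dist g h.
Proof.
case: g h => u ru [v rv]; elim: u v ru rv => [|a u IH] v ru rv.
  have -> : (FreeGroup ru)^-1%g = 1%g.
    by apply/eqP; rewrite invg_eq1; apply/eqP/val_inj.
  by rewrite mul1g.
case: v rv => [|b v] rv.
  by rewrite tree_dist_nil (_ : FreeGroup rv = 1%g) ?mulg1 ?size_free_inv //; apply: val_inj.
have ru' : reduced u by move: ru => /path_sorted.
rewrite [tree_dist _ _]/=; case: eqP => [ab|/eqP ab].
  subst b; have rv' : reduced v by move: rv => /path_sorted.
  by rewrite (gen_cons ru ru') (gen_cons rv rv') invgM -mulgA mulKg; apply: IH.
rewrite -[LHS]/(size (word_mul (word_inv (a :: u)) (b :: v))).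
rewrite word_mul_reduced_cat ?size_cat /word_inv ?size_rev ?size_map //.
rewrite map_cons rev_cons reduced_join -rev_cons -map_cons.
by rewrite rv (word_inv_reduced ru) letterVK eq_sym.
Qed.

Lemma free_qi : exists f K C,
  nat_qi (fun g h : F => word_norm free_gens (g^-1 * h)%g) (@tree_dist bool) f K C.
Proof.
apply: (@encode_qi _ letter_ok F (@word_of n) _ 0 (size (enum {: letter n}))).
- apply: children_boundsP => -[a|]; last first.
    by exists (Ordinal (ltnW n_gt1), true), (Ordinal (ltnW n_gt1), false).
  have [j ja] : exists j : 'I_n, j != a.1.
    have [e|] := eqVneq (Ordinal (ltnW n_gt1)) a.1; last by exists (Ordinal (ltnW n_gt1)).
    by exists (Ordinal n_gt1); rewrite -e.
  exists (j, true), (j, false); rewrite /letter_ok !xpair_eqE /= (negbTE ja).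
  by rewrite andbF.
- by move=> g; rewrite -reducedE word_ofP.
- by move=> w; rewrite -reducedE => rw; exists (FreeGroup rw).
- by move=> g h; rewrite free_word_norm free_dist.
- by move=> g h; rewrite free_word_norm free_dist addn0.
Qed.

End FreeGroupTree.

Lemma free_product_qi (R : realType) n p : 1 < n -> (2%:R : 'F_p)%R != 0%R ->
  qi_to_free_group R n (free_product p).
Proof.
move=> n1 two0; have [f [K [C fQ]]] := fp_qi two0; have [g [K' [C' gQ]]] := free_qi n1.
exists (fp_gens p), (free_gens n); split.
- exact: fp_generates.
- by move=> h; exists (size h); apply: free_spelled.
have [h [K2 [C2 hQ]]] :=
  nat_qi_cospan (@tree_dist_sym bool) (@tree_dist_triangle bool) fQ gQ.
exact: nat_qi_real hQ.
Qed.

Theorem corollary10 (R : realType) (n : nat) (hn : (2 <= n)%N) :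
  exists G G' : groupType,
    [/\ qi_to_free_group R n G /\ qi_to_free_group R n G',
        ~ (exists X : metricType R,
             [/\ [set: X] !=set0, proper_space X, geodesic_space X,
                 exists act : G -> X -> X,
                   [/\ acts_by_isometries act, properly_discontinuous act
                     & cocompact_action act]
               & exists act' : G' -> X -> X,
                   [/\ acts_by_isometries act', properly_discontinuous act'
                     & cocompact_action act']])
      & ~ (exists L : topologicalGroupType,
             [/\ locally_compact [set: L],
                 exists rho : UMagmaMorphism.type G L,
                   discrete_cocompact_rep rho /\ virtually_faithful rho
               & exists rho' : UMagmaMorphism.type G' L,
                   discrete_cocompact_rep rho' /\ virtually_faithful rho'])].
Proof.
(* The two smallest odd primes. *)
exists (free_product 3), (free_product 5); split.
- by split; apply: free_product_qi => //; apply: Fp_two_neq0.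
- exact: no_common_space.
- exact: no_common_group.
Qed.
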